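(* Let $\varepsilon\in(0,1)$, and let $q=q(n)$ be a positive integer depending on $n$. Consider, for each $n$, the rate-$1$ continuous-time Diaconis–Gangolli random walk on $1\times n$ contingency tables over $\mathbb{Z}_q$ (with any fixed coordinate sum), and let $d(t)$ and $t_{\mathrm{mix}}(\varepsilon)$ be as defined in the context. (a) Let $$\alpha:=\inf\Big\{z\ge 1:\ 4\varepsilon^2\ge \exp\Big(\tfrac{4+4e^{2/e}}{\sqrt z}\Big)-1\Big\}.$$ If $q/n\to\infty$ as $n\to\infty$, then for $t=t_n=\dfrac{nq^2\log(\alpha n)}{8\pi^2}\Big(1-\dfrac{1}{3q}\Big)^{-1}$ we have $d(t_n)\le \varepsilon+o(1)$ as $n\to\infty$ (i.e. $\limsup_{n\to\infty} d(t_n)\le\varepsilon$). (b) If $q/\sqrt{\log n}\to\infty$ as $n\to\infty$, then for all sufficiently large $n$, $$t_{\mathrm{mix}}(\varepsilon)\ \ge\ \frac{nq^2}{8\pi^2}\Big(\log n+\log\Big(1-\frac1n\Big)+\log\Big(\frac{\varepsilon^{-1}-1}{5}\Big)\Big).$$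
   Context: $\mathbb{Z}_q=\mathbb{Z}/q\mathbb{Z}$. A $1\times n$ contingency table over $\mathbb{Z}_q$ is a vector $x\in\mathbb{Z}_q^n$ with prescribed coordinate sum $s\in\mathbb{Z}_q$; the state space is $\Omega=\{x\in\mathbb{Z}_q^n:\sum_i x_i=s\}$. The rate-$1$ continuous-time Diaconis–Gangolli walk on $\Omega$ jumps at the times of a rate-$1$ Poisson process; at each jump, an ordered pair $(i,j)$ of distinct coordinates is chosen uniformly at random, a fair coin is flipped, and on heads coordinate $i$ is incremented by $+1$ and coordinate $j$ by $-1$, on tails coordinate $i$ by $-1$ and coordinate $j$ by $+1$. Let $H_t(x,\cdot)$ be the law at time $t$ started from $x$, $\pi$ the uniform distribution on $\Omega$, $\|\mu-\nu\|_{TV}=\max_{A\subset\Omega}|\mu(A)-\nu(A)|$, $d(t)=\max_{x\in\Omega}\|H_t(x,\cdot)-\pi\|_{TV}$, and $t_{\mathrm{mix}}(\varepsilon)=\inf\{t\ge0: d(t)\le\varepsilon\}$. *)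

(* Defs.v *)
From HB Require Import structures.
From mathcomp Require Import all_boot all_order all_algebra.
From mathcomp Require Import all_classical all_reals all_analysis.
Set Implicit Arguments. Unset Strict Implicit. Unset Printing Implicit Defensive.
Import Order.TTheory GRing.Theory Num.Theory.
Local Open Scope ring_scope.

(* Z_q is represented by 'I_q with the cyclic successor/predecessor
   ordS / ord_pred of fintype (i.e. +1 and -1 mod q). *)
Definition table (n q : nat) := {ffun 'I_n -> 'I_q}.

Definition Omega (n q s : nat) : {set table n q} :=
  [set x : table n q | ((\sum_(i < n) (x i : nat)) %% q == s %% q)%N].

Definition dg_move (n q : nat) (x : table n q) (i j : 'I_n) (b : bool) : table n q :=
  [ffun k => if k == i then (if b then ordS (x i) else ord_pred (x i))
             else if k == j then (if b then ord_pred (x j) else ordS (x j))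
             else x k].

(* one-step transition kernel of the jump chain: uniform ordered pair of
   distinct coordinates (n(n-1) choices) and a fair coin *)
Definition dg_P {R : realType} (n q : nat) (x y : table n q) : R :=
  \sum_(i < n) \sum_(j < n | i != j) \sum_(b : bool)
     ((dg_move x i j b == y)%:R / (2 * (n * (n - 1)))%:R).

Fixpoint dg_Pk {R : realType} (n q : nat) (k : nat) (x y : table n q) : R :=
  match k with
  | 0 => (x == y)%:R
  | k'.+1 => \sum_(z : table n q) dg_Pk k' x z * dg_P z y
  end.

(* continuous-time rate-1 kernel: H_t(x,y) = sum_k e^{-t} t^k/k! P^k(x,y)
   (jumps at the times of a rate-1 Poisson process) *)
Definition dg_H {R : realType} (n q : nat) (t : R) (x y : table n q) : R :=
  limn (fun N : nat =>
    \sum_(0 <= k < N) (expR (- t) * t ^+ k / (k`!)%:R * dg_Pk k x y)).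

Definition dg_tv {R : realType} (n q s : nat) (t : R) (x : table n q) : R :=
  \big[Num.max/0]_(A : {set table n q} | A \subset Omega n q s)
     `| \sum_(y in A) dg_H t x y - (#|A|)%:R / (#|Omega n q s|)%:R |.

Definition dg_d {R : realType} (n q s : nat) (t : R) : R :=
  \big[Num.max/0]_(x in Omega n q s) dg_tv s t x.

(* t_mix(eps) = inf { t >= 0 : d(t) <= eps }, in the extended reals
   (inf of the empty set is +oo) *)
Definition dg_tmix {R : realType} (n q s : nat) (eps : R) : \bar R :=
  ereal_inf [set t%:E | t in [set t : R | 0 <= t /\ dg_d n q s t <= eps]].

Definition dg_alpha {R : realType} (eps : R) : R :=
  inf [set z : R | 1 <= z /\
        expR ((4 + 4 * expR (2 / expR 1)) / Num.sqrt z) - 1 <= 4 * eps ^+ 2].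

(* Main.v *)
(** The walk is a convolution walk on the tables, so its kernel is diagonalised
    by the characters exp (2 i pi k . y / q), with eigenvalues
    lambda_k = (n (n - 1))^-1 * sum_{i <> j} cos (2 pi (k_i - k_j) / q).
    By Parseval, four times the squared total variation distance is at most
    q^-1 * sum exp (- 2 t (1 - lambda_k)) over the nonconstant k.

    Upper bound: if some k_i - k_j is larger than about sqrt q modulo q, the
    exponent is at least of order q log n, which beats the number q^n of
    frequencies because q / n is large.  Any other k is, up to a global shift,
    a vector of integers l with |sum l_i| <= n / 2, and then the exponent is at
    least log (alpha n) (M - (sum l_i)^2 / n) with M = sum l_i^2.  There are at
    most (2 e^(4/3) n / M)^M such vectors with M <= n / 2, and (alpha n)^(M / n)
    is at most 2 M when M / n is small, so these terms are dominated by the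
    geometric series of 16 / alpha; the terms with M of order n are negligible.

    Lower bound: second moments of the sum of the characters exp (2 i pi y_i / q)
    over the coordinates that start at 0. *)

Require Import Defs.
From HB Require Import structures.
From mathcomp Require Import all_boot all_order all_algebra.
From mathcomp Require Import all_classical all_reals all_analysis.
From mathcomp Require Import ring lra zify.
Set Implicit Arguments. Unset Strict Implicit. Unset Printing Implicit Defensive.
Import Order.TTheory GRing.Theory Num.Theory.
Import numFieldNormedType.Exports.
Local Open Scope ring_scope.

(** * Trigonometry on the integers modulo q *)

Section RootsOfUnity.
Variables (R : realType) (q : nat).
Hypothesis q_gt0 : (0 < q)%N.

Definition angle (z : int) : R := 2 * pi * z%:~R / q%:R.
Definition root_cos (z : int) : R := cos (angle z).
Definition root_sin (z : int) : R := sin (angle z).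
Local Notation wc := root_cos.
Local Notation ws := root_sin.

Let qR0 : q%:R != 0 :> R. Proof. by rewrite pnatr_eq0 -lt0n. Qed.

Lemma angleD a b : angle (a + b) = angle a + angle b.
Proof. by rewrite /angle intrD; field. Qed.

Lemma angleN a : angle (- a) = - angle a.
Proof. by rewrite /angle mulrNz; field. Qed.

Lemma wcD a b : wc (a + b) = wc a * wc b - ws a * ws b.
Proof. by rewrite /root_cos angleD cosD. Qed.

Lemma wsD a b : ws (a + b) = ws a * wc b + wc a * ws b.
Proof. by rewrite /root_sin angleD sinD. Qed.

Lemma wcN a : wc (- a) = wc a.
Proof. by rewrite /root_cos angleN cosN. Qed.

Lemma wsN a : ws (- a) = - ws a.
Proof. by rewrite /root_sin angleN sinN. Qed.

Lemma wcB a b : wc (a - b) = wc a * wc b + ws a * ws b.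
Proof. by rewrite wcD wcN wsN mulrN opprK. Qed.

Lemma wc0 : wc 0 = 1.
Proof. by rewrite /root_cos /angle mulr0 mul0r cos0. Qed.

Lemma ws0 : ws 0 = 0.
Proof. by rewrite /root_sin /angle mulr0 mul0r sin0. Qed.

Lemma wc2Dws2 a : wc a ^+ 2 + ws a ^+ 2 = 1.
Proof. exact: cos2Dsin2. Qed.

Lemma wc_le1 a : wc a <= 1.
Proof. exact: cos_le1. Qed.

Lemma angleMq_nat (m : nat) : angle (m%:Z * q%:Z) = (pi *+ 2) *+ m.
Proof. by rewrite /angle rmorphM /= -!pmulrn -[pi *+ 2 *+ m]mulr_natl -[pi *+ 2]mulr_natl; field. Qed.

Lemma wc_ws_period_nat (m : nat) : wc (m%:Z * q%:Z) = 1 /\ ws (m%:Z * q%:Z) = 0.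
Proof.
rewrite /root_cos /root_sin angleMq_nat -[X in cos X]add0r -[X in sin X]add0r.
by rewrite (periodicn (@cosD2pi R)) (periodicn (@sinD2pi R)) cos0 sin0.
Qed.

Lemma wc_ws_period (m : int) : wc (m * q%:Z) = 1 /\ ws (m * q%:Z) = 0.
Proof.
case: (intP m) => [|k|k]; first exact: (wc_ws_period_nat 0).
  exact: wc_ws_period_nat.
by rewrite mulNr wcN wsN; have [-> ->] := wc_ws_period_nat k.+1; rewrite oppr0.
Qed.

Lemma wc_congr a b : (q%:Z %| a - b)%Z -> wc a = wc b.
Proof.
move=> /dvdzP [m e]; rewrite -[a](subrK b) e wcD.
by have [-> ->] := wc_ws_period m; rewrite mul1r mul0r subr0.
Qed.

Lemma ws_congr a b : (q%:Z %| a - b)%Z -> ws a = ws b.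
Proof.
move=> /dvdzP [m e]; rewrite -[a](subrK b) e wsD.
by have [-> ->] := wc_ws_period m; rewrite mul1r mul0r add0r.
Qed.

Lemma wc_dvd a : (q%:Z %| a)%Z -> wc a = 1.
Proof. by move=> h; rewrite (@wc_congr a 0) ?subr0 // wc0. Qed.

(** Half-angle formula 1 - cos (2 x) = 2 sin^2 x, at x = pi r / q in (0, pi), where r is the nonzero
    residue of [a]. *)
Lemma wc_lt1 a : ~~ (q%:Z %| a)%Z -> wc a < 1.
Proof.
move=> Nqa.
have [r [rq ->]] : exists r : nat, (0 < r < q)%N /\ wc a = wc r.
  have qz0 : (q : int) != 0 by lia.
  have := modz_ge0 a qz0; have /= := ltz_pmod a (_ : 0 < q%:Z).
  move=> /(_ q_gt0) lt ge; exists (absz (a %% q)%Z); rewrite gez0_abs //.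
  split; last by apply: wc_congr; rewrite -eqz_mod_dvd modz_mod.
  have : (a %% q)%Z != 0 by apply: contra Nqa => /eqP h; apply/dvdz_mod0P.
  by lia.
case/andP: rq => r0 rq; rewrite /root_cos /angle -pmulrn.
have -> : 2 * pi * r%:R / q%:R = (pi * r%:R / q%:R) *+ 2 :> R by rewrite -mulr_natl; field.
set x := pi * _ / _; have q0 : 0 < q%:R :> R by rewrite ltr0n.
have sx : 0 < sin x.
  apply: sin_gt0_pi; rewrite /x divr_gt0 ?mulr_gt0 ?pi_gt0 ?ltr0n //=.
  by rewrite ltr_pdivrMr // ltr_pM2l ?pi_gt0 // ltr_nat.
rewrite cos_mulr2n cos2sin2 mulr2n; nra.
Qed.

(** Orthogonality of characters in real form: reindexing by [h] multiplies the complex sum C + i S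
    by the root of unity w = exp (2 i pi b / q), and w <> 1. *)
Lemma wc_sum0 (T : finType) (D : {set T}) (h : T -> T) (phi : T -> int) (b : int) :
  injective h -> (forall y, (h y \in D) = (y \in D)) ->
  (forall y, (q%:Z %| phi (h y) - (phi y + b))%Z) ->
  ~~ (q%:Z %| b)%Z -> \sum_(y in D) wc (phi y) = 0.
Proof.
move=> hi hD hphi /wc_lt1 b1.
set C := LHS; pose S := \sum_(y in D) ws (phi y).
have eC : C = C * wc b - S * ws b.
  rewrite {1}/C (reindex_inj hi) /= (eq_bigl _ _ hD).
  rewrite /C /S !mulr_suml -sumrB; apply: eq_bigr => y _.
  by rewrite (wc_congr (hphi y)) wcD.
have eS : S = S * wc b + C * ws b.
  rewrite {1}/S (reindex_inj hi) /= (eq_bigl _ _ hD).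
  rewrite /C /S !mulr_suml -big_split; apply: eq_bigr => y _.
  by rewrite (ws_congr (hphi y)) wsD.
have e2 := wc2Dws2 b.
(* The factor is |1 - w|^2; it appears on eliminating S from the two equations. *)
have : C * (2 - 2 * wc b) = 0.
  have -> : 2 - 2 * wc b = (1 - wc b) ^+ 2 + ws b ^+ 2.
    by rewrite -[2 in LHS]/(1 + 1) -{2}e2; ring.
  have e1 : C * (1 - wc b) = - S * ws b by rewrite mulrBr mulr1 {1}eC; ring.
  have e3 : S * (1 - wc b) = C * ws b by rewrite mulrBr mulr1 {1}eS; ring.
  by rewrite mulrDr expr2 mulrA e1 mulrAC mulNr e3 expr2; ring.
by move/eqP; rewrite mulf_eq0 => /orP [/eqP //|/eqP c0]; exfalso; lra.
Qed.

End RootsOfUnity.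

(** * The heat kernel in Fourier coordinates *)

Lemma ordS_congr (q : nat) (v : 'I_q) : (q%:Z %| (ordS v : nat)%:Z - ((v : nat)%:Z + 1))%Z.
Proof.
by rewrite -eqz_mod_dvd /= -PoszD addn1 !modz_nat modn_mod.
Qed.

Lemma ord_pred_congr (q : nat) (v : 'I_q) :
  (q%:Z %| (ord_pred v : nat)%:Z - ((v : nat)%:Z - 1))%Z.
Proof.
have := ordS_congr (ord_pred v); rewrite ord_predK -rpredN /= => h.
by rewrite (_ : _ - _ = - ((v : nat)%:Z - ((ord_pred v : nat)%:Z + 1))) //=; ring.
Qed.

Section Dot.
Variables (n q : nat).
Implicit Types (x y : table n q) (k : 'I_n -> int).

(* Frequencies are integer vectors; they matter only modulo q. *)
Definition dot k x : int := \sum_i k i * (x i : nat)%:Z.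

Lemma dot_congr k x x' (d : 'I_n -> int) :
  (forall l, (q%:Z %| (x' l : nat)%:Z - ((x l : nat)%:Z + d l))%Z) ->
  (q%:Z %| dot k x' - (dot k x + \sum_l k l * d l))%Z.
Proof.
move=> h; rewrite /dot -big_split -sumrB /=; apply: rpred_sum => l _.
by rewrite -mulrDr -mulrBr; apply: dvdz_mull.
Qed.

Definition sgb (b : bool) : int := if b then 1 else -1.

Lemma dg_move_congr k x i j b : i != j ->
  (q%:Z %| dot k (dg_move x i j b) - (dot k x + sgb b * (k i - k j)))%Z.
Proof.
move=> ij.
have -> : sgb b * (k i - k j) = \sum_l k l * (sgb b * ((l == i)%:R - (l == j)%:R)).
  under eq_bigr do rewrite mulrCA mulrBr.
  rewrite -mulr_sumr sumrB; congr (_ * (_ - _)).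
    by rewrite (bigD1 i) //= eqxx mulr1 big1 ?addr0 // => l /negPf ->; rewrite mulr0.
  by rewrite (bigD1 j) //= eqxx mulr1 big1 ?addr0 // => l /negPf ->; rewrite mulr0.
apply: dot_congr => l; rewrite ffunE.
case: (eqVneq l i) => [->|li].
  rewrite (negPf ij) subr0 mulr1; case: b => /=; [exact: ordS_congr|exact: ord_pred_congr].
case: (eqVneq l j) => [->|lj].
  rewrite sub0r mulrN1 /sgb; case: b; rewrite ?opprK; [exact: ord_pred_congr|exact: ordS_congr].
by rewrite subrr mulr0 addr0 subrr.
Qed.

Lemma dg_moveK i j b : i != j -> cancel (fun x => dg_move x i j b) (fun x => dg_move x i j (~~ b)).
Proof.
move=> ij x; apply/ffunP => l; rewrite !ffunE.
case: (eqVneq l i) => [->|li]; first by rewrite eqxx; case: b => /=; rewrite ?ordSK ?ord_predK.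
case: (eqVneq l j) => [->|//].
by rewrite eq_sym (negPf ij) eqxx; case: b => /=; rewrite ?ordSK ?ord_predK.
Qed.

Lemma dg_move_inj i j b : i != j -> injective (fun x => dg_move x i j b).
Proof. by move=> ij; apply: can_inj (dg_moveK b ij). Qed.

Lemma OmegaE s x : (x \in Omega n q s) = (q%:Z %| dot (fun=> 1) x - s%:Z)%Z.
Proof.
rewrite inE /dot; under [in RHS]eq_bigr do rewrite mul1r.
by rewrite -eqz_mod_dvd -(big_morph Posz PoszD erefl) !modz_nat.
Qed.

Lemma Omega_congr s x y : x \in Omega n q s -> y \in Omega n q s ->
  (q%:Z %| dot (fun=> 1) y - dot (fun=> 1) x)%Z.
Proof.
rewrite !OmegaE => hx hy.
rewrite (_ : _ - _ = (dot (fun=> 1) y - s%:Z) - (dot (fun=> 1) x - s%:Z)); first exact: rpredB.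
by ring.
Qed.

Lemma Omega_dg_move s x i j b : i != j -> (dg_move x i j b \in Omega n q s) = (x \in Omega n q s).
Proof.
move=> ij; have := dg_move_congr (fun=> 1) x b ij; rewrite subrr mulr0 addr0 => h.
rewrite !OmegaE -(rpredDl (dot (fun=> 1) x - s%:Z) h).
by rewrite addrA subrK.
Qed.

Definition freq (k : table n q) : 'I_n -> int := fun i => (k i : nat)%:Z.

Lemma dot_freqC (k x : table n q) : dot (freq k) x = dot (freq x) k.
Proof. by apply: eq_bigr => i _; rewrite /freq mulrC. Qed.

Lemma dotB k k' x : dot (fun i => k i - k' i) x = dot k x - dot k' x.
Proof. by rewrite /dot -sumrB; apply: eq_bigr => i _; rewrite mulrBl. Qed.

Lemma dotMl v k x : dot (fun i => v * k i) x = v * dot k x.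
Proof. by rewrite /dot mulr_sumr; apply: eq_bigr => i _; rewrite mulrA. Qed.

(** The translation used for orthogonality on the space of all tables, as [dg_move] is used on
    [Omega]. *)
Definition incr_at (i : 'I_n) (x : table n q) : table n q :=
  [ffun l => if l == i then ordS (x l) else x l].

Lemma incr_at_inj i : injective (incr_at i).
Proof.
move=> x y /ffunP h; apply/ffunP => l; have := h l; rewrite !ffunE.
by case: ifP => // _ /ordS_inj.
Qed.

Lemma incr_at_congr k x i : (q%:Z %| dot k (incr_at i x) - (dot k x + k i))%Z.
Proof.
have -> : k i = \sum_l k l * (l == i)%:R.
  by rewrite (bigD1 i) //= eqxx mulr1 big1 ?addr0 // => l /negPf ->; rewrite mulr0.
apply: dot_congr => l; rewrite ffunE.
by case: (eqVneq l i) => _; [exact: ordS_congr|rewrite addr0 subrr].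
Qed.

End Dot.

(** * Diagonalisation of the kernel by characters *)

Section Kernel.
Local Open Scope classical_set_scope.
Local Open Scope ring_scope.
Variables (R : realType) (n q : nat).
Hypothesis q_gt0 : (0 < q)%N.
Implicit Types (x y : table n q) (k : 'I_n -> int).
Local Notation wc := (root_cos R q).
Local Notation P := (@dg_P R n q).
Local Notation Pk := (@dg_Pk R n q).
Local Notation H := (@dg_H R n q).

Definition eigenvalue k : R :=
  \sum_i \sum_(j | i != j) wc (k i - k j) / (n * (n - 1))%:R.
Local Notation eigval := eigenvalue.

Lemma sum_dg_P x (f : table n q -> R) : \sum_y P x y * f y =
  \sum_i \sum_(j | i != j) \sum_b f (dg_move x i j b) / (2 * (n * (n - 1)))%:R.
Proof.
under eq_bigr => y _.
  rewrite /dg_P mulr_suml; under eq_bigr => i _.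
    rewrite mulr_suml; under eq_bigr => j _ do rewrite mulr_suml.
    over.
  over.
rewrite exchange_big; apply: eq_bigr => i _; rewrite exchange_big; apply: eq_bigr => j _.
rewrite exchange_big; apply: eq_bigr => b _ /=.
rewrite (bigD1 (dg_move x i j b)) //= eqxx big1 ?addr0 => [|y]; first by rewrite mulrAC mul1r mulrC.
by rewrite eq_sym => /negPf ->; rewrite !mul0r.
Qed.

(** Heads and tails average cos (u + d) and cos (u - d) into cos u cos d. The free phase [c] allows
    Fourier inversion with cosines alone. *)
Lemma dg_P_wc k (c : int) x :
  \sum_y P x y * wc (dot k y + c) = eigval k * wc (dot k x + c).
Proof.
rewrite sum_dg_P /eigenvalue mulr_suml; apply: eq_bigr => i _.
rewrite mulr_suml; apply: eq_bigr => j ij; rewrite big_bool /=.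
rewrite (@wc_congr _ _ q_gt0 (dot k (dg_move x i j true) + c) (dot k x + c + (k i - k j))); last first.
  have := dg_move_congr k x true ij; rewrite /= mul1r.
  by rewrite [X in (_ %| X)%Z](_ : _ = dot k (dg_move x i j true) + c - (dot k x + c + (k i - k j))) //; ring.
rewrite (@wc_congr _ _ q_gt0 (dot k (dg_move x i j false) + c) (dot k x + c - (k i - k j))); last first.
  have := dg_move_congr k x false ij; rewrite /= mulN1r.
  by rewrite [X in (_ %| X)%Z](_ : _ = dot k (dg_move x i j false) + c - (dot k x + c - (k i - k j))) //; ring.
rewrite (wcD _ q_gt0 (dot k x + c) (k i - k j)) (wcB _ q_gt0 (dot k x + c) (k i - k j)).
by rewrite natrM invfM; move: ((n * (n - 1))%:R^-1) => N; field.
Qed.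

Lemma dg_Pk_wc m k (c : int) x :
  \sum_y Pk m x y * wc (dot k y + c) = eigval k ^+ m * wc (dot k x + c).
Proof.
elim: m => [|m IHm] /=.
  rewrite (bigD1 x) //= eqxx big1 ?addr0 // => y.
  by rewrite eq_sym => /negPf ->; rewrite mul0r.
under eq_bigr do rewrite mulr_suml; rewrite exchange_big /=.
under eq_bigr => z _.
  under eq_bigr do rewrite -mulrA.
  rewrite -mulr_sumr dg_P_wc mulrCA.
  over.
by rewrite -mulr_sumr IHm mulrA exprS.
Qed.

Lemma sum_wc_dot0 k (c : int) i : ~~ (q%:Z %| k i)%Z ->
  \sum_(y : table n q) wc (dot k y + c) = 0.
Proof.
move=> qk; apply: etrans (@wc_sum0 R q q_gt0 _ [set: table n q]%SET (@incr_at n q i)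
  (fun y => dot k y + c) (k i) _ _ _ qk).
- by apply: eq_bigl => y; rewrite inE.
- exact: incr_at_inj.
- by move=> y; rewrite !inE.
- move=> y; rewrite (_ : _ - _ = dot k (incr_at i y) - (dot k y + k i)); last by ring.
  exact: incr_at_congr.
Qed.

Lemma table_neq (z y : table n q) : z != y -> exists i, ~~ (q%:Z %| freq z i - freq y i)%Z.
Proof.
move=> zy; have [i zyi] : exists i, z i != y i.
  apply/existsP; rewrite -negb_forall; apply: contra zy => /forallP h.
  by apply/eqP/ffunP => i; apply/eqP.
by exists i; rewrite /freq -eqz_mod_dvd !modz_nat !modn_small.
Qed.

(** The pairing is symmetric in table and frequency, so orthogonality over tables is also
    orthogonality over frequencies. *)
Lemma sum_wc_table (z y : table n q) :
  \sum_(k : table n q) wc (dot (freq k) z - dot (freq k) y) = (q ^ n)%:R * (z == y)%:R.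
Proof.
case: (eqVneq z y) => [->|/table_neq [i qi]].
  under eq_bigr do rewrite subrr wc0.
  by rewrite sumr_const card_ffun !card_ord mulr1.
rewrite mulr0 -[RHS](sum_wc_dot0 (k := fun i => freq z i - freq y i) 0 qi).
by apply: eq_bigr => k _; rewrite addr0 dotB (dot_freqC _ z) (dot_freqC _ y).
Qed.

(** Fourier inversion: the point mass at [y] is expanded in characters, each of which is an
    eigenfunction. *)
Lemma dg_PkE m x y : Pk m x y =
  (q ^ n)%:R^-1 * \sum_(k : table n q) eigval (freq k) ^+ m * wc (dot (freq k) x - dot (freq k) y).
Proof.
have qn0 : (q ^ n)%:R != 0 :> R by rewrite pnatr_eq0 expn_eq0 negb_and -lt0n q_gt0.
transitivity (\sum_z Pk m x z * (z == y)%:R).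
  rewrite (bigD1 y) //= eqxx mulr1 big1 ?addr0 // => z /negPf ->; by rewrite mulr0.
transitivity ((q ^ n)%:R^-1 * \sum_(k : table n q) \sum_z Pk m x z * wc (dot (freq k) z - dot (freq k) y)).
  rewrite exchange_big mulr_sumr; apply: eq_bigr => z _ /=.
  by rewrite -mulr_sumr sum_wc_table mulrCA mulKf.
by congr (_ * _); apply: eq_bigr => k _; rewrite dg_Pk_wc.
Qed.

Definition heat_coef (t : R) k : R := expR (- (t * (1 - eigval k))).
Local Notation heat := heat_coef.

Lemma cvg_poisson (t l : R) :
  (\sum_(0 <= m < N) (expR (- t) * t ^+ m / (m`!)%:R * l ^+ m) @[N --> \oo]) --> expR (- (t * (1 - l))).
Proof.
have -> : - (t * (1 - l)) = - t + t * l by ring.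
rewrite expRD.
have /(cvgMl_tmp) := @is_cvg_series_exp_coeff R (t * l).
move=> /(_ (expR (- t))).
apply: cvg_trans; apply: near_eq_cvg; apply: nearW => N /=.
rewrite /series /= mulr_sumr; apply: eq_bigr => m _.
by rewrite /exp_coeff /= exprMn; ring.
Qed.

Lemma cvgn_sum (I : finType) (f : I -> nat -> R) (l : I -> R) :
  (forall i, f i N @[N --> \oo] --> l i) ->
  (\sum_i f i N @[N --> \oo]) --> \sum_i l i.
Proof. by move=> h; apply: cvg_big => [|i _]; [exact: add_continuous|exact: h]. Qed.

Lemma dg_H_cvg t x y :
  (\sum_(0 <= m < N) (expR (- t) * t ^+ m / (m`!)%:R * Pk m x y) @[N --> \oo]) -->
  (q ^ n)%:R^-1 * \sum_(k : table n q) heat t (freq k) * wc (dot (freq k) x - dot (freq k) y).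
Proof.
under eq_cvg => N.
  under eq_bigr => m _ do rewrite dg_PkE mulrCA mulr_sumr.
  rewrite -mulr_sumr exchange_big /=.
  under eq_bigr => k _.
    under eq_bigr => m _ do rewrite mulrA.
    rewrite -mulr_suml.
    over.
  over.
apply: cvgMl_tmp; apply: cvgn_sum => k; apply: cvgMr_tmp; exact: cvg_poisson.
Qed.

Lemma dg_HE t x y : H t x y =
  (q ^ n)%:R^-1 * \sum_(k : table n q) heat t (freq k) * wc (dot (freq k) x - dot (freq k) y).
Proof. by apply/cvg_lim => //; exact: dg_H_cvg. Qed.

Lemma dg_H_cvgP t x y :
  (\sum_(0 <= m < N) (expR (- t) * t ^+ m / (m`!)%:R * Pk m x y) @[N --> \oo]) --> H t x y.
Proof. by rewrite dg_HE; exact: dg_H_cvg. Qed.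

Lemma dg_H_wc t k (c : int) x :
  \sum_y H t x y * wc (dot k y + c) = heat t k * wc (dot k x + c).
Proof.
have h1 : (\sum_y (\sum_(0 <= m < N) (expR (- t) * t ^+ m / (m`!)%:R * Pk m x y)) * wc (dot k y + c)
    @[N --> \oo]) --> \sum_y H t x y * wc (dot k y + c).
  by apply: cvgn_sum => y; apply: cvgMr_tmp; exact: dg_H_cvgP.
rewrite -(cvg_lim _ h1) //; apply/cvg_lim => //.
under eq_cvg => N.
  under eq_bigr do rewrite mulr_suml.
  rewrite exchange_big /=.
  under eq_bigr => m _.
    under eq_bigr do rewrite -mulrA.
    rewrite -mulr_sumr dg_Pk_wc mulrA.
    over.
  rewrite -mulr_suml.
  over.
by apply: cvgMr_tmp; exact: cvg_poisson.
Qed.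

Lemma dg_P_ge0 x y : 0 <= P x y.
Proof.
by apply: sumr_ge0 => i _; apply: sumr_ge0 => j _; apply: sumr_ge0 => b _; rewrite divr_ge0.
Qed.

Lemma dg_Pk_ge0 m x y : 0 <= Pk m x y.
Proof.
elim: m y => [|m IHm] y /=; first by case: eqP.
by apply: sumr_ge0 => z _; rewrite mulr_ge0 ?dg_P_ge0.
Qed.

Lemma dg_H_ge0 t x y : 0 <= t -> 0 <= H t x y.
Proof.
move=> t0; apply: (limr_ge (cvgP _ (@dg_H_cvgP t x y))); apply: nearW => N.
by apply: sumr_ge0 => m _; rewrite !mulr_ge0 ?expR_ge0 ?exprn_ge0 ?invr_ge0 ?dg_Pk_ge0.
Qed.

Lemma dg_P_Omega s x y : x \in Omega n q s -> y \notin Omega n q s -> P x y = 0.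
Proof.
move=> xs ys; rewrite /dg_P big1 // => i _; rewrite big1 // => j ij; rewrite big1 // => b _.
case: eqP => [e|]; last by rewrite mul0r.
by move: ys; rewrite -e Omega_dg_move // xs.
Qed.

Lemma dg_Pk_Omega m s x y : x \in Omega n q s -> y \notin Omega n q s -> Pk m x y = 0.
Proof.
move=> xs; elim: m y => [|m IHm] y ys /=.
  by case: eqP => // e; move: ys; rewrite -e xs.
apply: big1 => z _; have [zs|zs] := boolP (z \in Omega n q s).
  by rewrite (dg_P_Omega zs ys) mulr0.
by rewrite IHm // mul0r.
Qed.

Lemma dg_H_Omega t s x y : x \in Omega n q s -> y \notin Omega n q s -> H t x y = 0.
Proof.
move=> xs ys; apply/cvg_lim => //; apply: cvg_near_cst; apply: nearW => N.
by apply: big1 => m _; rewrite (dg_Pk_Omega _ xs ys) mulr0.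
Qed.

Lemma dg_H_wc_Omega s t k (c : int) x : x \in Omega n q s ->
  \sum_(y in Omega n q s) H t x y * wc (dot k y + c) = heat t k * wc (dot k x + c).
Proof.
move=> xs; rewrite -dg_H_wc [RHS](bigID (mem (Omega n q s))) /= [X in _ = _ + X]big1 ?addr0 //.
by move=> y ys; rewrite (dg_H_Omega _ xs ys) mul0r.
Qed.

End Kernel.

(** * Total variation and the L2 norm *)

(** Nonnegativity of the weighted variance, cleared of denominators; when the total weight is 0, all
    weights vanish. *)
Lemma weighted_cauchy_schwarz (R : realFieldType) (T : finType) (D : pred T) (w g : T -> R) :
  (forall y, D y -> 0 <= w y) ->
  (\sum_(y | D y) w y * g y) ^+ 2 <= (\sum_(y | D y) w y) * \sum_(y | D y) w y * g y ^+ 2.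
Proof.
move=> w0; set W := \sum_(y | D y) w y; set G := \sum_(y | D y) w y * g y; set Q := \sum_(y | D y) _ * _ ^+ 2.
have W0 : 0 <= W by apply: sumr_ge0.
have hQ : 0 <= W ^+ 2 * Q - W * G ^+ 2.
  have -> : W ^+ 2 * Q - W * G ^+ 2 = \sum_(y | D y) w y * (W * g y - G) ^+ 2.
    transitivity (\sum_(y | D y) (W ^+ 2 * (w y * g y ^+ 2) - 2 * W * G * (w y * g y) + G ^+ 2 * w y)).
      by rewrite big_split sumrB /= -!mulr_sumr -/W -/G -/Q; ring.
    by apply: eq_bigr => y _; ring.
  by apply: sumr_ge0 => y Dy; rewrite mulr_ge0 ?w0 ?sqr_ge0.
move: W0; rewrite le_eqVlt => /orP [/eqP W0|W0].
  have w00 y : D y -> w y = 0.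
    by move=> Dy; apply/eqP; move/esym/eqP: W0; rewrite psumr_eq0 // => /allP /(_ y (mem_index_enum y)); rewrite Dy.
  by rewrite -W0 mul0r /G big1 ?expr0n // => y Dy; rewrite w00 // mul0r.
rewrite -subr_ge0 -(pmulr_rge0 _ W0).
by rewrite mulrBr mulrA -expr2.
Qed.

Lemma half_sum_norm (R : realFieldType) (T : finType) (D A : {set T}) (f : T -> R) :
  \sum_(y in D) f y = 0 -> A \subset D ->
  `|\sum_(y in A) f y| <= 2^-1 * \sum_(y in D) `|f y|.
Proof.
move=> f0 AD; move: f0; rewrite (big_setID A) [X in _ <= _ * X](big_setID A) /= (finset.setIidPr AD) => f0.
have h1 := ler_norm_sum (index_enum T) f (mem A).
have h2 := ler_norm_sum (index_enum T) f (mem (D :\: A)).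
have e : \sum_(y in D :\: A) f y = - \sum_(y in A) f y by lra.
by move: h2; rewrite e normrN; lra.
Qed.

(** The positive set carries exactly half of the L1 mass: it is the event that attains the total
    variation distance. *)
Lemma half_sum_norm_pos (R : realFieldType) (T : finType) (D : {set T}) (f : T -> R) :
  \sum_(y in D) f y = 0 ->
  \sum_(y in D) `|f y| = 2 * \sum_(y in [set z in D | 0 < f z]) f y.
Proof.
move=> f0; set A := [set z in D | 0 < f z].
have AD : A \subset D by apply/fintype.subsetP => z; rewrite inE => /andP[].
move: f0; rewrite (big_setID A) [X in _ -> X = _](big_setID A) /= (finset.setIidPr AD) => f0.
rewrite (eq_bigr f); last by move=> y; rewrite inE => /andP[_ /gtr0_norm].
rewrite [X in _ + X](eq_bigr (fun y => - f y)); last first.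
  by move=> y; rewrite !inE => /andP [h yD]; move: h; rewrite yD /= -leNgt => /ler0_norm.
by rewrite sumrN; lra.
Qed.

Section TotalVariation.
Variables (R : realType) (n q s : nat).
Hypotheses (n_gt1 : (1 < n)%N) (q_gt0 : (0 < q)%N).
Implicit Types (x y : table n q) (k : table n q).
Local Notation wc := (root_cos R q).
Local Notation ws := (root_sin R q).
Local Notation H := (@dg_H R n q).
Local Notation eigval := (@eigenvalue R n q).
Local Notation heat := (@heat_coef R n q).
Local Notation Om := (Omega n q s).
Local Notation i0 := (Ordinal (ltnW n_gt1)).

(** A constant frequency has a constant character on [Omega], so only the others contribute to the
    distance from uniform. *)
Definition nonconst k := [exists i, exists j, k i != k j].

Lemma nonconstPn k : ~~ nonconst k -> forall i, k i = k i0.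
Proof.
move=> h i; apply/eqP; apply: contraNT h => h.
by apply/existsP; exists i; apply/existsP; exists i0.
Qed.

Lemma card_const : #|[set k : table n q | ~~ nonconst k]| = q.
Proof.
rewrite -[RHS]card_ord -cardsT -(card_imset _ (f := fun v : 'I_q => [ffun=> v] : table n q)); last first.
  by move=> u v /ffunP /(_ i0); rewrite !ffunE.
apply: eq_card => k; rewrite inE; apply/idP/imsetP.
  by move=> /nonconstPn h; exists (k i0) => //; apply/ffunP => i; rewrite ffunE.
by move=> [v _ ->]; apply/existsPn => i; apply/existsPn => j; rewrite !ffunE negbK.
Qed.

Lemma sum_wc_mul (a : int) : \sum_(v < q) wc ((v : nat)%:Z * a) = q%:R * (q%:Z %| a)%Z%:R.
Proof.
have [qa|qa] := boolP (q%:Z %| a)%Z.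
  under eq_bigr => v _ do rewrite (wc_dvd _ q_gt0) ?dvdz_mull //.
  by rewrite sumr_const card_ord mulr1.
rewrite mulr0; apply: etrans (@wc_sum0 R q q_gt0 _ [set: 'I_q] (@ordS q)
  (fun v => (v : nat)%:Z * a) a _ _ _ qa).
- by apply: eq_bigl => y; rewrite inE.
- exact: ordS_inj.
- by move=> y; rewrite !inE.
- move=> y; rewrite (_ : _ - _ = (((ordS y : nat)%:Z) - ((y : nat)%:Z + 1)) * a); last by ring.
  by apply: dvdz_mulr; exact: ordS_congr.
Qed.

(** The indicator of [Omega] is an average of [q] characters of the coordinate sum; summed over all
    tables, only the trivial one survives. *)
Lemma card_Omega : (q%:R * #|Om|%:R = (q ^ n)%:R :> R).
Proof.
transitivity (\sum_(x : table n q) \sum_(v < q) wc ((v : nat)%:Z * (dot (fun=> 1) x - s%:Z))).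
  under eq_bigr do rewrite sum_wc_mul -OmegaE.
  rewrite -mulr_sumr -sum1_card natr_sum big_mkcond; congr (_ * _).
  by apply: eq_bigr => x _; case: (x \in Om).
rewrite exchange_big (bigD1 (Ordinal q_gt0)) //= [X in _ + X]big1 ?addr0.
  under eq_bigr => x _ do rewrite (wc_dvd _ q_gt0) ?dvdz_mulr ?dvdz0 //.
  by rewrite sumr_const card_ffun !card_ord.
move=> v v0; under eq_bigr => x _ do rewrite mulrBr -dotMl.
apply: (@sum_wc_dot0 _ _ _ q_gt0 _ _ i0).
rewrite /= mulr1 -[X in (_ %| X)%Z]subr0 -eqz_mod_dvd mod0z modz_nat modn_small //.
Qed.

Lemma card_OmegaV : #|Om|%:R^-1 = (q ^ n)%:R^-1 * q%:R :> R.
Proof.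
have q0 : q%:R != 0 :> R by rewrite pnatr_eq0 -lt0n.
by rewrite -card_Omega invfM mulrAC mulVf // mul1r.
Qed.

Lemma card_Omega_gt0 : 0 < #|Om|%:R :> R.
Proof.
have q0 : 0 < q%:R :> R by rewrite ltr0n.
by rewrite -(pmulr_rgt0 _ q0) card_Omega ltr0n expn_gt0 q_gt0.
Qed.

Lemma const_dvd k x y : ~~ nonconst k -> x \in Om -> y \in Om ->
  (q%:Z %| dot (freq k) x - dot (freq k) y)%Z.
Proof.
move=> /nonconstPn h xs ys.
have e z : dot (freq k) z = freq k i0 * dot (fun=> 1) z.
  by rewrite -dotMl; apply: eq_bigr => i _; rewrite mulr1 /freq h.
by rewrite !e -mulrBr dvdz_mull //; exact: Omega_congr ys xs.
Qed.

Lemma sum_offdiag_const (c : R) :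
  \sum_(i < n) \sum_(j < n | i != j) c / (n * (n - 1))%:R = c.
Proof.
under eq_bigr => i _.
  rewrite sumr_const (eq_card (B := predC1 i)); last by move=> j; rewrite !inE eq_sym.
  rewrite cardC1 card_ord.
  over.
rewrite sumr_const card_ord -mulrnA -[LHS]mulr_natr (mulnC n.-1) -subn1 divfK //.
by rewrite pnatr_eq0 muln_eq0 negb_or -!lt0n subn_gt0 n_gt1 ltnW.
Qed.

Lemma eigval_const k : ~~ nonconst k -> eigval (freq k) = 1.
Proof.
move=> /nonconstPn h; rewrite -[RHS](sum_offdiag_const 1) /eigenvalue.
by apply: eq_bigr => i _; apply: eq_bigr => j _; rewrite /freq !h subrr wc0.
Qed.

(** The [q] constant frequencies contribute q / q^n, which is exactly the uniform mass. *)
Lemma dg_H_sub_unif t x y : x \in Om -> y \in Om -> H t x y - #|Om|%:R^-1 =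
  (q ^ n)%:R^-1 * \sum_(k | nonconst k) heat t (freq k) * wc (dot (freq k) x - dot (freq k) y).
Proof.
move=> xs ys; rewrite dg_HE // card_OmegaV (bigID nonconst) /= mulrDr.
rewrite [X in _ + _ * X - _](eq_bigr (fun=> 1)) => [|k kc].
  rewrite sumr_const (_ : #|_| = q) ?addrK //.
  by rewrite -[RHS]card_const; apply: eq_card => k; rewrite !inE.
by rewrite /heat_coef eigval_const // subrr mulr0 oppr0 expR0 mul1r (wc_dvd _ q_gt0) // const_dvd.
Qed.

Lemma sum_wc_Omega (k : 'I_n -> int) (c : int) i j : i != j -> ~~ (q%:Z %| k i - k j)%Z ->
  \sum_(y in Om) wc (dot k y + c) = 0.
Proof.
move=> ij h; apply: (@wc_sum0 R q q_gt0 _ _ (fun y => dg_move y i j true) _ (k i - k j)) => //.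
- exact: dg_move_inj.
- by move=> y; rewrite Omega_dg_move.
- move=> y; have := dg_move_congr k y true ij.
  by rewrite mul1r (_ : _ - _ = dot k (dg_move y i j true) + c - (dot k y + c + (k i - k j))) //; ring.
Qed.

Lemma sum_dg_H t x : x \in Om -> \sum_(y in Om) H t x y = 1.
Proof.
move=> xs; have := @dg_H_wc_Omega R n q q_gt0 s t (fun=> 0) 0 x xs.
have e y : dot (fun=> 0) y = 0 :> int by rewrite /dot big1 // => i _; rewrite mul0r.
rewrite e add0r wc0 mulr1 /heat_coef.
under eq_bigr do rewrite e add0r wc0 mulr1.
move=> ->; rewrite (_ : eigenvalue _ _ _ = 1) ?subrr ?mulr0 ?oppr0 ?expR0 //.
rewrite -[RHS](sum_offdiag_const 1) /eigenvalue.
by apply: eq_bigr => i _; apply: eq_bigr => j _; rewrite subrr wc0.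
Qed.

Lemma sum_unif : \sum_(y in Om) #|Om|%:R^-1 = 1 :> R.
Proof. by rewrite sumr_const -[LHS]mulr_natl divff // gt_eqF ?card_Omega_gt0. Qed.

Lemma sum_sqr_fourier_le (a : table n q -> R) (D : pred (table n q)) x :
  \sum_(y : table n q) (\sum_(k | D k) a k * wc (dot (freq k) x - dot (freq k) y)) ^+ 2
    <= (q ^ n)%:R * \sum_(k | D k) a k ^+ 2.
Proof.
(* With the sine transform added, only differences of frequencies occur, and
   orthogonality of characters applies. *)
pose d k y := dot (freq k) x - dot (freq k) y.
apply: (@le_trans _ _ (\sum_(y : table n q) ((\sum_(k | D k) a k * wc (d k y)) ^+ 2 +
   (\sum_(k | D k) a k * ws (d k y)) ^+ 2))).
  by apply: ler_sum => y _; rewrite lerDl sqr_ge0.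
rewrite le_eqVlt; apply/orP; left; apply/eqP.
transitivity (\sum_(y : table n q) \sum_(k | D k) \sum_(l | D l) a k * a l * wc (d k y - d l y)).
  apply: eq_bigr => y _; rewrite !expr2 !mulr_suml -big_split; apply: eq_bigr => k _ /=.
  rewrite !mulr_sumr -big_split; apply: eq_bigr => l _ /=.
  by rewrite (wcB _ q_gt0 (d k y) (d l y)); ring.
rewrite exchange_big /= mulr_sumr; apply: eq_bigr => k Dk.
rewrite exchange_big (bigD1 k) //= [X in _ + X]big1 ?addr0.
  under eq_bigr => y _ do rewrite subrr wc0 mulr1.
  by rewrite sumr_const card_ffun !card_ord mulr_natl expr2.
move=> l /andP [_ lk]; rewrite -mulr_sumr.
have [i qi] := table_neq lk.
rewrite (eq_bigr (fun y => wc (dot (fun i => freq l i - freq k i) y + (dot (freq k) x - dot (freq l) x)))).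
  by rewrite (@sum_wc_dot0 _ _ _ q_gt0 _ _ i) ?mulr0.
by move=> y _; congr wc; rewrite dotB /d; ring.
Qed.

Lemma sum_sub_unif0 t x : x \in Om -> \sum_(y in Om) (H t x y - #|Om|%:R^-1) = 0.
Proof. by move=> xs; rewrite sumrB sum_dg_H // sum_unif subrr. Qed.

Lemma dg_tv_term t x (A : {set table n q}) :
  \sum_(y in A) H t x y - #|A|%:R / #|Om|%:R = \sum_(y in A) (H t x y - #|Om|%:R^-1).
Proof. by rewrite sumrB sumr_const mulr_natl. Qed.

(** Cauchy-Schwarz on [Omega] passes from L1 to L2, and Parseval bounds the L2 norm; squaring the
    coefficients doubles the time. *)
Lemma dg_tv_le t x : x \in Om ->
  dg_tv s t x <= 2^-1 * Num.sqrt (q%:R^-1 * \sum_(k | nonconst k) heat (2 * t) (freq k)).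
Proof.
move=> xs; set E := \sum_(k | _) _.
have E0 : 0 <= E by apply: sumr_ge0 => k _; exact: expR_ge0.
apply: bigmax_le => [|A AO]; first by rewrite mulr_ge0 ?sqrtr_ge0 // invr_ge0.
rewrite dg_tv_term; apply: le_trans (half_sum_norm (sum_sub_unif0 t xs) AO) _.
rewrite ler_pM2l ?invr_gt0 //; pose f y := H t x y - #|Om|%:R^-1.
rewrite -[leLHS]/(\sum_(y in Om) `|f y|).
rewrite -[leLHS]ger0_norm ?sumr_ge0 // -sqrtr_sqr ler_sqrt; last first.
  by rewrite mulr_ge0 // invr_ge0.
have := @weighted_cauchy_schwarz _ _ (mem Om) (fun=> 1 : R) (fun y => `|f y|) (fun _ _ => ler01).
under eq_bigr do rewrite mul1r; under [X in _ * X]eq_bigr do rewrite mul1r real_normK ?num_real //.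
move=> /le_trans -> //.
rewrite sumr_const -(ler_pM2l (_ : 0 < q%:R * (q ^ n)%:R^-1)); last first.
  by rewrite divr_gt0 ?ltr0n // expn_gt0 q_gt0.
rewrite !mulrA.
have qn0 : (q ^ n)%:R != 0 :> R by rewrite pnatr_eq0 expn_eq0 negb_and -lt0n q_gt0.
have -> : q%:R / (q ^ n)%:R * #|Om|%:R = 1 :> R by rewrite mulrAC card_Omega divff.
have -> : q%:R / (q ^ n)%:R / q%:R = (q ^ n)%:R^-1 :> R.
  by rewrite mulrAC divff ?mul1r // pnatr_eq0 -lt0n.
rewrite mul1r.
(* The Fourier expression makes sense off [Omega] too, and extending the sum of squares to all
   tables only enlarges it. *)
apply: (@le_trans _ _ ((q ^ n)%:R^-1 ^+ 2 * \sum_(y : table n q)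
   (\sum_(k | nonconst k) heat t (freq k) * wc (dot (freq k) x - dot (freq k) y)) ^+ 2)).
  rewrite mulr_sumr [leRHS](bigID (mem Om)) /= -[leLHS]addr0 lerD //; last first.
    by apply: sumr_ge0 => y _; rewrite mulr_ge0 ?sqr_ge0.
  by apply: ler_sum => y ys; rewrite /f dg_H_sub_unif // exprMn.
rewrite expr2 -mulrA ler_pM2l ?invr_gt0 ?lt0r ?qn0 ?ler0n //.
rewrite -(ler_pM2l (_ : 0 < (q ^ n)%:R)) ?lt0r ?qn0 ?ler0n // mulVKf //.
apply: le_trans (sum_sqr_fourier_le _ _ _) _; rewrite ler_pM2l ?lt0r ?qn0 ?ler0n //.
rewrite (_ : \sum_(k | _) _ = E) //; apply: eq_bigr => k _.
by rewrite /heat_coef -expRM_natl; congr (expR _); ring.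
Qed.

Lemma sum_norm_sub_unif_le t x : x \in Om ->
  \sum_(y in Om) `|H t x y - #|Om|%:R^-1| <= 2 * dg_tv s t x.
Proof.
move=> xs; rewrite (half_sum_norm_pos (sum_sub_unif0 t xs)) ler_pM2l //.
rewrite -dg_tv_term; apply: le_trans (ler_norm _) _.
apply: (le_bigmax_cond _ (fun A : {set table n q} => `|\sum_(y in A) H t x y - #|A|%:R / #|Om|%:R|)).
by apply/fintype.subsetP => z; rewrite inE => /andP[].
Qed.

End TotalVariation.

(** * Second moments and the lower bound *)

Section LowerBound.
Variables (R : realType) (n q : nat).
Hypotheses (n_gt1 : (1 < n)%N) (q_gt0 : (0 < q)%N).
Implicit Types (x y : table n q).
Local Notation wc := (root_cos R q).
Local Notation ws := (root_sin R q).
Local Notation H := (@dg_H R n q).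
Local Notation eigval := (@eigenvalue R n q).
Local Notation heat := (@heat_coef R n q).
Local Notation i0 := (Ordinal (ltnW n_gt1)).
Local Notation N := ((n - 1)%:R : R).

Lemma sum_wc_pairs (D : pred 'I_n) (k : 'I_n -> int) :
  (\sum_(i | D i) wc (k i)) ^+ 2 + (\sum_(i | D i) ws (k i)) ^+ 2 =
  \sum_(i | D i) \sum_(j | D j) wc (k i - k j).
Proof.
rewrite !expr2 !mulr_suml -big_split; apply: eq_bigr => i _ /=.
rewrite !mulr_sumr -big_split; apply: eq_bigr => j _ /=.
by rewrite (wcB _ q_gt0).
Qed.

(** The squared modulus of the sum of characters runs over all ordered pairs; the n diagonal ones
    contribute 1 each and are removed. *)
Lemma eigvalE (k : 'I_n -> int) :
  eigval k = ((\sum_i wc (k i)) ^+ 2 + (\sum_i ws (k i)) ^+ 2 - n%:R) / (n * (n - 1))%:R.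
Proof.
rewrite sum_wc_pairs /eigenvalue.
have -> : n%:R = \sum_(i < n) 1 :> R by rewrite sumr_const card_ord.
rewrite -sumrB mulr_suml; apply: eq_bigr => i _.
rewrite [in RHS](bigD1 i) //= subrr wc0 addrAC subrr add0r mulr_suml.
by apply: eq_bigl => j; rewrite eq_sym.
Qed.

Definition basis_freq (i : 'I_n) : 'I_n -> int := fun l => (l == i)%:R.
Local Notation e := basis_freq.

Lemma dot_basis i y : dot (e i) y = (y i : nat)%:Z.
Proof.
rewrite /dot (bigD1 i) //= /e eqxx mul1r big1 ?addr0 // => j /negPf ->.
by rewrite mul0r.
Qed.

Lemma natrN1 : n%:R = N + 1 :> R.
Proof. by rewrite natrB ?subrK // ltnW. Qed.

Let N_gt0 : 0 < N. Proof. by rewrite ltr0n subn_gt0. Qed.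

Lemma eigval_basis i : 1 - eigval (e i) = 2 / n%:R * (1 - wc 1).
Proof.
rewrite eigvalE.
have -> : \sum_l wc (e i l) = N + wc 1.
  rewrite (bigD1 i) //= /e eqxx addrC; congr (_ + _).
  rewrite (eq_bigr (fun=> 1)) => [|l /negPf ->]; last by rewrite wc0.
  by rewrite sumr_const cardC1 card_ord subn1.
have -> : \sum_l ws (e i l) = ws 1.
  by rewrite (bigD1 i) //= /e eqxx big1 ?addr0 // => l /negPf ->; rewrite ws0.
have ec := wc2Dws2 R q 1.
have -> : (N + wc 1) ^+ 2 + ws 1 ^+ 2 - n%:R = N * (N - 1 + 2 * wc 1).
  have -> : ws 1 ^+ 2 = 1 - wc 1 ^+ 2 by lra.
  by rewrite natrN1; ring.
rewrite natrM natrN1; field.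
by rewrite !gt_eqF // addr_gt0.
Qed.

(** The characters sum to n - 2 + 2 c with c = cos (2 pi / q). The excess over twice the gap of one
    basis frequency is a positive multiple of c (1 - c), which yields the negative correlation of
    two coordinates. *)
Lemma eigval_basisB i j : i != j -> 0 <= wc 1 ->
  2 * (2 / n%:R * (1 - wc 1)) <= 1 - eigval (fun l => e i l - e j l).
Proof.
move=> ij w0; rewrite eigvalE.
have big2 (f : int -> R) : \sum_l f (e i l - e j l) = f 1 + f (-1) + (N - 1) * f 0.
  rewrite (bigD1 i) //= (bigD1 j) /=; last by rewrite eq_sym.
  rewrite /e !eqxx (negPf ij) eq_sym (negPf ij) subr0 sub0r addrA; congr (_ + _).
  rewrite (eq_bigr (fun=> f 0)) => [|l /andP [/negPf -> /negPf ->]]; last by rewrite subrr.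
  rewrite sumr_const -[LHS]mulr_natl; congr (_ * _).
  have -> : #|[pred l | l != i & l != j]| = #|~: [set i; j]|.
    by apply: eq_card => l; rewrite !inE negb_or.
  have := cardsC [set i; j]; rewrite cards2 ij card_ord /= => h.
  by have := natrN1; rewrite -{1}h natrD; lra.
rewrite !big2 wcN // wsN // wc0 ws0 !(mulr1, mulr0, subrr, addr0) expr0n /= addr0.
have w1 : wc 1 <= 1 by exact: wc_le1.
have N1 : 1 <= N by rewrite ler1n subn_gt0.
rewrite natrM natrN1.
have -> : 1 - ((wc 1 + wc 1 + (N - 1)) ^+ 2 - (N + 1)) / ((N + 1) * N) =
   2 * (1 - wc 1) * (2 * N + 2 * wc 1) / ((N + 1) * N).
  by field; rewrite !gt_eqF // addr_gt0.
rewrite ler_pdivlMr ?mulr_gt0 ?addr_gt0 //.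
have -> : 2 * (2 / (N + 1) * (1 - wc 1)) * ((N + 1) * N) = 2 * (1 - wc 1) * (2 * N).
  by field; rewrite gt_eqF // addr_gt0.
by rewrite ler_wpM2l ?mulr_ge0 ?subr_ge0 // lerDl mulr_ge0.
Qed.

(** Coordinate 0 absorbs the prescribed sum, so that at the start the characters of all other
    coordinates equal 1. *)
Definition corner (s : 'I_q) : table n q := [ffun i => if i == i0 then s else Ordinal q_gt0].

Lemma corner_Omega (s : 'I_q) : corner s \in Omega n q s.
Proof.
rewrite inE (bigD1 i0) //= ffunE eqxx big1 ?addn0 // => i /negPf h.
by rewrite ffunE h.
Qed.

(* With Phi = sum_{i <> 0} exp (2 i pi y_i / q), and m its mean under the walk,
   Cauchy-Schwarz with weights |mu - nu| <= mu + nu is applied to the real part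
   of Phi - m / 2.  Starting from the corner table, m is real, and the variance
   of Phi is at most n - 1 because its terms are negatively correlated. *)
Lemma tv_lower_bound (s : 'I_q) (t eps : R) : (1 < q)%N -> 0 <= t -> 0 <= wc 1 ->
  dg_tv s t (corner s) <= eps ->
  N * expR (- (2 * t * (2 / n%:R * (1 - wc 1)))) * (1 - eps) <= 4 * eps.
Proof.
move=> q1 t0 w0 tv; set x := corner s in tv *.
have xs : x \in Omega n q s by exact: corner_Omega.
pose Om := Omega n q s.
have q1F : ~~ (q%:Z %| 1)%Z by rewrite dvdz1 /=; case: q q1 => [|[|]].
pose D : pred 'I_n := predC1 i0.
have cardD : \sum_(i | D i) 1 = N :> R by rewrite sumr_const cardC1 card_ord subn1.
have x0 i : D i -> (x i : nat) = 0%N by move=> /negPf h; rewrite ffunE h.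
pose h1 := expR (- (t * (2 / n%:R * (1 - wc 1)))); pose m := N * h1.
pose Cs y : R := \sum_(i | D i) wc (y i : nat)%:Z.
pose Sn y : R := \sum_(i | D i) ws (y i : nat)%:Z.
pose mu y := H t x y; pose nu (y : table n q) : R := #|Om|%:R^-1.
have mu0 y : 0 <= mu y by exact: dg_H_ge0.
have nu0 y : 0 <= nu y by rewrite invr_ge0.
have mu1 : \sum_(y in Om) mu y = 1 by apply: sum_dg_H.
have nu1 : \sum_(y in Om) nu y = 1 by apply: sum_unif.
have muC : \sum_(y in Om) mu y * Cs y = m.
  under eq_bigr do rewrite mulr_sumr; rewrite exchange_big /=.
  rewrite /m -cardD mulr_suml; apply: eq_bigr => i Di.
  have := @dg_H_wc_Omega R n q q_gt0 s t (e i) 0 x xs.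
  rewrite dot_basis x0 // addr0 wc0 mulr1 mul1r /heat_coef eigval_basis -/h1 => <-.
  by apply: eq_bigr => y _; rewrite dot_basis addr0.
have sq y : Cs y ^+ 2 + Sn y ^+ 2 = N + \sum_(i | D i) \sum_(j | D j && (j != i)) wc (dot (fun l => e i l - e j l) y + 0).
  rewrite sum_wc_pairs -cardD -big_split; apply: eq_bigr => i Di /=.
  rewrite (bigD1 i) //= subrr wc0; congr (_ + _).
  by apply: eq_bigr => j _; rewrite addr0 dotB !dot_basis.
(* Diagonal pairs give N. For i <> j the gap is at least doubled, so each pair contributes at most
   the square of [h1]. *)
have muE : \sum_(y in Om) mu y * (Cs y ^+ 2 + Sn y ^+ 2) <= N + m ^+ 2.
  under eq_bigr do rewrite sq mulrDr.
  rewrite big_split /= -mulr_suml mu1 mul1r lerD2l.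
  under eq_bigr do rewrite mulr_sumr; rewrite exchange_big /=.
  have -> : m ^+ 2 = \sum_(i | D i) N * h1 ^+ 2.
    by rewrite sumr_const cardC1 card_ord -subn1 -[RHS]mulr_natl /m; ring.
  apply: ler_sum => i Di.
  under eq_bigr do rewrite mulr_sumr; rewrite exchange_big /=.
  apply: (@le_trans _ _ (\sum_(j | D j && (j != i)) h1 ^+ 2)); last first.
    rewrite -cardD mulr_suml [leRHS](bigID (fun j => j != i)) /=.
    under eq_bigr do rewrite -[_ ^+ 2]mul1r.
    rewrite lerDl; apply: sumr_ge0 => j _; by rewrite mulr_ge0 ?sqr_ge0.
  apply: ler_sum => j /andP [Dj ji].
  rewrite (@dg_H_wc_Omega R n q q_gt0 s t _ 0 x xs).
  rewrite (_ : dot _ x + 0 = 0); last by rewrite dotB !dot_basis !x0.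
  rewrite wc0 mulr1 /heat_coef /h1 -expRM_natl ler_expR.
  rewrite mulrN lerN2 (mulrCA 2 t) ler_wpM2l //.
  by apply: eigval_basisB => //; rewrite eq_sym.
have nuC : \sum_(y in Om) nu y * Cs y = 0.
  under eq_bigr do rewrite mulr_sumr; rewrite exchange_big /= big1 // => i Di.
  rewrite -mulr_sumr (eq_bigr (fun y => wc (dot (e i) y + 0))).
    by rewrite (@sum_wc_Omega _ _ _ _ q_gt0 _ _ i i0) ?mulr0 // /e eqxx eq_sym (negPf Di) subr0.
  by move=> y _; rewrite dot_basis addr0.
have nuE : \sum_(y in Om) nu y * (Cs y ^+ 2 + Sn y ^+ 2) = N.
  under eq_bigr do rewrite sq mulrDr.
  rewrite big_split /= -mulr_suml nu1 mul1r -mulr_sumr.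
  rewrite exchange_big [X in _ + _ * X]big1 ?mulr0 ?addr0 // => i Di.
  rewrite exchange_big big1 // => j /andP [Dj ji].
  apply: (@sum_wc_Omega _ _ _ _ q_gt0 _ _ i i0) => //.
  by rewrite /e eqxx !(eq_sym i0) (negPf Di) (negPf Dj) eq_sym (negPf ji) !subr0.
have del0 : \sum_(y in Om) (mu y - nu y) = 0 by rewrite sumrB mu1 nu1 subrr.
have delC : \sum_(y in Om) (mu y - nu y) * (Cs y - m / 2) = m.
  under eq_bigr do rewrite mulrBr.
  rewrite sumrB -mulr_suml del0 mul0r subr0.
  by under eq_bigr do rewrite mulrBl; rewrite sumrB muC nuC subr0.
(* Centring at m / 2 treats both laws alike: each contributes at most N + m^2 / 4. *)
have tot : \sum_(y in Om) (mu y + nu y) * ((Cs y - m / 2) ^+ 2 + Sn y ^+ 2) <= 2 * N + m ^+ 2 / 2.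
  have split (r : table n q -> R) : \sum_(y in Om) r y * ((Cs y - m / 2) ^+ 2 + Sn y ^+ 2) =
      \sum_(y in Om) r y * (Cs y ^+ 2 + Sn y ^+ 2) - m * (\sum_(y in Om) r y * Cs y)
      + m ^+ 2 / 4 * \sum_(y in Om) r y.
    by rewrite !mulr_sumr -sumrB -big_split; apply: eq_bigr => y _ /=; field.
  under eq_bigr do rewrite mulrDl.
  rewrite big_split /= !split muC nuC mu1 nu1 nuE.
  by move: muE; rewrite expr2; lra.
have l1 := sum_norm_sub_unif_le n_gt1 q_gt0 t xs.
have CS := @weighted_cauchy_schwarz R _ (mem Om) (fun y => `|mu y - nu y|)
  (fun y => `|Cs y - m / 2|) (fun _ _ => normr_ge0 _).
have m2 : m ^+ 2 <= 2 * eps * (2 * N + m ^+ 2 / 2).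
  apply: (@le_trans _ _ ((\sum_(y in Om) `|mu y - nu y| * `|Cs y - m / 2|) ^+ 2)).
    rewrite -(ler_sqrt _ (sqr_ge0 _)) !sqrtr_sqr -{1}delC.
    apply: le_trans (ler_norm_sum _ _ _) _.
    by under eq_bigr do rewrite normrM; exact: ler_norm.
  apply: le_trans CS _; apply: ler_pM.
  - by apply: sumr_ge0.
  - by apply: sumr_ge0 => y _; rewrite mulr_ge0 ?sqr_ge0.
  - by apply: le_trans l1 _; rewrite ler_pM2l.
  apply: le_trans tot; apply: ler_sum => y _.
  apply: ler_pM; [exact: normr_ge0|exact: sqr_ge0| |].
    by apply: le_trans (ler_normB _ _) _; rewrite !ger0_norm.
  by rewrite real_normK ?num_real // lerDl sqr_ge0.
have -> : expR (- (2 * t * (2 / n%:R * (1 - wc 1)))) = h1 ^+ 2.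
  by rewrite /h1 -expRM_natl; congr expR; ring.
(* Solved for m^2, [m2] reads m^2 (1 - eps) <= 4 eps N; one factor N cancels. *)
rewrite -(ler_pM2l N_gt0); move: m2; rewrite /m.
have -> : (N * h1) ^+ 2 = N * (N * h1 ^+ 2) by ring.
by lra.
Qed.

End LowerBound.

(** * Eigenvalue estimates *)

Section TrigBounds.
Variable R : realType.
Implicit Types (x : R) (f df : R -> R).

(** Mean value theorem; iterated below, it climbs from cos <= 1 to the cubic Taylor bound for the
    sine. *)
Lemma ge0_of_derive f df : (forall x, is_derive x 1 f (df x)) -> f 0 = 0 ->
  (forall x, 0 < x -> 0 <= df x) -> forall x, 0 <= x -> 0 <= f x.
Proof.
move=> hf f0 hdf x; rewrite le_eqVlt => /orP [/eqP <-|x0]; first by rewrite f0.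
have [|c] := @MVT R f df _ _ x0 (fun y _ => hf y).
  apply: continuous_subspaceT => y.
  by apply/differentiable_continuous/derivable1_diffP; apply: ex_derive.
rewrite in_itv /= f0 !subr0 => /andP [c0 _] ->.
by rewrite mulr_ge0 ?hdf // ltW.
Qed.

Lemma sin_lex x : 0 <= x -> sin x <= x.
Proof.
move=> x0; rewrite -subr_ge0.
move: x0; apply: (@ge0_of_derive (fun y => y - sin y) (fun y => 1 - cos y)) => [|y _].
  by rewrite sin0 subr0.
by rewrite subr_ge0 cos_le1.
Qed.

Lemma cos_ge1B_half x : 0 <= x -> 0 <= cos x - 1 + x ^+ 2 / 2.
Proof.
apply: (@ge0_of_derive (fun y => cos y - 1 + y ^+ 2 / 2) (fun y => - sin y + y)).
- move=> y; apply: is_derive_eq; rewrite /GRing.scale /=; lra.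
- by rewrite cos0 subrr expr0n /= mul0r addr0.
- by move=> y y0; rewrite addrC subr_ge0 sin_lex // ltW.
Qed.

Lemma sin_ge_cubic x : 0 <= x -> 0 <= sin x - x + x ^+ 3 / 6.
Proof.
apply: (@ge0_of_derive (fun y => sin y - y + y ^+ 3 / 6) (fun y => cos y - 1 + y ^+ 2 / 2)).
- move=> y; apply: is_derive_eq; rewrite /GRing.scale /=; lra.
- by rewrite sin0 subrr expr0n /= mul0r addr0.
- by move=> y y0; apply: cos_ge1B_half; exact: ltW.
Qed.

Lemma one_sub_cos_le x : 1 - cos x <= x ^+ 2 / 2.
Proof.
rewrite -cos_norm -[x ^+ 2]real_normK ?num_real //.
have := cos_ge1B_half (normr_ge0 x); lra.
Qed.

(** With y = x / 2, 1 - cos x = 2 sin^2 y and sin y >= y (1 - y^2 / 6), while (1 - y^2 / 6)^2 >= 1 -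
    y^2 / 3. For x^2 >= 12 the left side is nonpositive; otherwise y^2 <= 3 makes the squaring
    legitimate. *)
Lemma one_sub_cos_ge x : x ^+ 2 / 2 * (1 - x ^+ 2 / 12) <= 1 - cos x.
Proof.
rewrite -cos_norm -[x ^+ 2]real_normK ?num_real //; move: `|x| (normr_ge0 x) => {}x x0.
have [h|h] := leP 12 (x ^+ 2).
  apply: (@le_trans _ _ 0); last by rewrite subr_ge0 cos_le1.
  have := sqr_ge0 x; nra.
have -> : 1 - cos x = 2 * sin (x / 2) ^+ 2.
  have -> : cos x = cos ((x / 2) *+ 2) by congr cos; rewrite -mulr_natl; lra.
  by rewrite cos_mulr2n cos2sin2 -mulr_natl; ring.
have y0 : 0 <= x / 2 by lra.
have := sin_ge_cubic y0; set y := x / 2 in y0 *; have -> : x = 2 * y by rewrite /y; lra.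
move=> hs; have y3 : y ^+ 2 <= 3 by rewrite /y exprMn exprVn; lra.
have : (y * (1 - y ^+ 2 / 6)) ^+ 2 <= sin y ^+ 2.
  rewrite ler_sqr ?nnegrE.
  - by move: hs; rewrite exprS; lra.
  - by rewrite mulr_ge0 //; lra.
  - apply: le_trans (_ : y - y ^+ 3 / 6 <= _); last by lra.
    have -> : y - y ^+ 3 / 6 = y * (1 - y ^+ 2 / 6) by rewrite exprS; ring.
    by rewrite mulr_ge0 //; lra.
have := sqr_ge0 (y * y); nra.
Qed.

Lemma pi_le4 : pi <= 4 :> R.
Proof. by have := pihalf_lt2 R; lra. Qed.

End TrigBounds.

(** * Decay of a single frequency at the mixing time *)

Section SpectralGap.
Variables (R : realType) (n q : nat).
Hypotheses (n_gt1 : (1 < n)%N) (q_gt0 : (0 < q)%N).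
Implicit Types (k l : 'I_n -> int).
Local Notation wc := (root_cos R q).
Local Notation ws := (root_sin R q).
Local Notation eigval := (@eigenvalue R n q).
Local Notation heat := (@heat_coef R n q).

Let qR : 0 < q%:R :> R. Proof. by rewrite ltr0n. Qed.
Let q1R : 1 <= q%:R :> R. Proof. by rewrite ler1n. Qed.
Let nR : 2 <= n%:R :> R. Proof. by rewrite ler_nat. Qed.

Lemma one_sub_eigval k :
  1 - eigval k = (\sum_i \sum_j (1 - wc (k i - k j))) / (n%:R * (n%:R - 1)).
Proof.
have q1 := q1R; have n2 := nR; have p0 := pi_gt0 R.
have -> : \sum_i \sum_j (1 - wc (k i - k j)) = n%:R * n%:R - \sum_i \sum_j wc (k i - k j).
  under eq_bigr do rewrite sumrB sumr_const card_ord.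
  by rewrite sumrB sumr_const card_ord mulr_natl.
rewrite eigvalE // sum_wc_pairs // natrM (natrN1 _ n_gt1).
have N0 : 0 < (n - 1)%:R :> R by rewrite ltr0n subn_gt0.
by field; rewrite !gt_eqF //; lra.
Qed.

(** The inequality |p - r|^2 <= 2 |p|^2 + 2 |r|^2 for p = z_a - 1 and r = z_b - 1, where z_a = exp
    (2 i pi a / q). *)
Lemma wc_triangle a b : 1 - wc (a - b) <= 2 * (1 - wc a) + 2 * (1 - wc b).
Proof.
rewrite (wcB _ q_gt0); have := wc2Dws2 R q a; have := wc2Dws2 R q b.
set x := wc a; set y := wc b; set u := ws a; set v := ws b => h1 h2.
have : 0 <= (x + y - 2) ^+ 2 + (u + v) ^+ 2 by rewrite addr_ge0 ?sqr_ge0.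
nra.
Qed.

(** By [wc_triangle], for each b the entries of rows i and j in column b together pay at least half
    the gap of the pair. *)
Lemma sum_gap_ge_pair k i j : i != j ->
  n%:R / 2 * (1 - wc (k i - k j)) <= \sum_a \sum_b (1 - wc (k a - k b)).
Proof.
move=> ij; have pos a b : 0 <= 1 - wc (k a - k b) by rewrite subr_ge0 wc_le1.
rewrite (bigD1 i) // (bigD1 j) /=; last by rewrite eq_sym.
rewrite addrA -[leLHS]addr0 lerD //; last first.
  by apply: sumr_ge0 => a _; apply: sumr_ge0.
rewrite -big_split /=.
have -> : n%:R / 2 * (1 - wc (k i - k j)) = \sum_(b < n) (1 - wc (k i - k j)) / 2.
  by rewrite sumr_const card_ord -[RHS]mulr_natl; lra.
apply: ler_sum => b _.
have := wc_triangle (k i - k b) (k j - k b).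
by rewrite (_ : k i - k b - (k j - k b) = k i - k j); [lra|ring].
Qed.

(** [L] stands for log (alpha n), and [tE] is the choice of time with its correction factor
    cleared. *)
Variables (L t : R).
Hypotheses (L_ge0 : 0 <= L)
  (tE : t * (1 - 1 / (3 * q%:R)) = n%:R * q%:R ^+ 2 * L / (8 * pi ^+ 2)).

Let pi0 : 0 < pi :> R. Proof. exact: pi_gt0. Qed.

Lemma t_ge0 : 0 <= t.
Proof.
have q1 := q1R; have n2 := nR; have p0 := pi_gt0 R.
have h : 0 < 1 - 1 / (3 * q%:R) :> R.
  by rewrite subr_gt0 ltr_pdivrMr; lra.
rewrite -(pmulr_lge0 _ h) tE !mulr_ge0 ?invr_ge0 ?exprn_ge0 ?mulr_ge0 //; lra.
Qed.

(* For an angle th <= 2 / sqrt q the relative error th^2 / 12 of the quadratic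
   approximation to 1 - cos th is at most 1 / (3 q), which is the correction
   factor of the mixing time. *)
Definition cutoff : R := cos (2 / Num.sqrt q%:R).

Let sq0 : 0 < Num.sqrt q%:R :> R. Proof. by rewrite sqrtr_gt0. Qed.

(** One far pair makes the double sum of order n at least n / q. The exponent is then at least q L /
    (4 pi^2), and pi <= 4 gives the constant 64. *)
Lemma heat_far k i j : i != j -> wc (k i - k j) < cutoff ->
  heat (2 * t) k <= expR (- (q%:R * L / 64)).
Proof.
have q1 := q1R; have n2 := nR; have p0 := pi_gt0 R.
move=> ij far; rewrite /heat_coef ler_expR lerN2 one_sub_eigval.
have := one_sub_cos_ge (2 / Num.sqrt q%:R : R); rewrite -/cutoff exprMn exprVn sqr_sqrtr ?ler0n // => h1.
have h2 : 2 / q%:R * (1 - 1 / (3 * q%:R)) <= 1 - wc (k i - k j).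
  apply: (@le_trans _ _ (1 - cutoff)); last by rewrite lerD2l lerN2 ltW.
  apply: le_trans h1; rewrite le_eqVlt; apply/orP; left; apply/eqP.
  by field; rewrite gt_eqF.
set S := \sum_i \sum_j (1 - wc (k i - k j)); have hS : n%:R / q%:R * (1 - 1 / (3 * q%:R)) <= S.
  apply: le_trans (sum_gap_ge_pair _ ij).
  rewrite (_ : n%:R / q%:R * _ = n%:R / 2 * (2 / q%:R * (1 - 1 / (3 * q%:R)))); last by field; rewrite gt_eqF.
  by rewrite ler_wpM2l //; lra.
have nn : 0 < n%:R * (n%:R - 1) :> R by rewrite mulr_gt0; lra.
apply: (@le_trans _ _ (2 * t * ((n%:R / q%:R * (1 - 1 / (3 * q%:R))) / (n%:R * (n%:R - 1))))).
  rewrite (_ : 2 * t * _ = 2 * (t * (1 - 1 / (3 * q%:R))) / q%:R / (n%:R - 1)); last first.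
    by field; rewrite !gt_eqF //; lra.
  rewrite tE (_ : 2 * _ / _ / _ = q%:R * L / (4 * pi ^+ 2) * (n%:R / (n%:R - 1))); last first.
    by field; rewrite !gt_eqF //; lra.
  apply: (@le_trans _ _ (q%:R * L / (4 * pi ^+ 2))).
    rewrite ler_wpM2l ?mulr_ge0 ?ler0n //.
    rewrite lef_pV2 ?posrE ?mulr_gt0 ?exprn_gt0 //.
    have := pi_le4 R; nra.
  rewrite ler_peMr ?divr_ge0 ?mulr_ge0 ?exprn_ge0 //; try lra.
  by rewrite ler_pdivlMr; lra.
by rewrite ler_wpM2l ?mulr_ge0 ?t_ge0 // ler_wpM2r // invr_ge0 ltW.
Qed.

(** The quadratic bound applies to every pair, and the (l_i - l_j)^2 sum to 2 (n M - A^2). By [tE]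
    all constants cancel, leaving L (n M - A^2) / (n - 1). *)
Lemma heat_near k l : (forall i j, (q%:Z %| k i - k j - (l i - l j))%Z) ->
  (forall i j, pi ^+ 2 * (l i - l j)%:~R ^+ 2 <= q%:R :> R) ->
  heat (2 * t) k <= expR (- (L * (\sum_i (l i)%:~R ^+ 2 - (\sum_i (l i)%:~R) ^+ 2 / n%:R))).
Proof.
have q1 := q1R; have n2 := nR; have p0 := pi_gt0 R.
move=> kl small; rewrite /heat_coef ler_expR lerN2 one_sub_eigval.
set M := \sum_i (l i)%:~R ^+ 2; set A := \sum_i (l i)%:~R; set S := \sum_i \sum_j (1 - wc (k i - k j)).
pose d i j : R := (l i - l j)%:~R.
have gap i j : 2 * pi ^+ 2 / q%:R ^+ 2 * (1 - 1 / (3 * q%:R)) * d i j ^+ 2 <= 1 - wc (k i - k j).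
  rewrite (wc_congr _ q_gt0 (kl i j)) /root_cos /angle -/(d i j).
  apply: le_trans (one_sub_cos_ge _); set th := 2 * pi * d i j / q%:R.
  have thE : th ^+ 2 = 4 * pi ^+ 2 / q%:R ^+ 2 * d i j ^+ 2 by rewrite /th; field; rewrite gt_eqF.
  have th_le : th ^+ 2 / 12 <= 1 / (3 * q%:R).
    rewrite thE (_ : _ / 12 = (pi ^+ 2 * d i j ^+ 2) / (3 * q%:R ^+ 2)); last by field; rewrite gt_eqF.
    rewrite ler_pdivrMr ?mulr_gt0 ?exprn_gt0 // (_ : 1 / _ * _ = q%:R); last by field; rewrite gt_eqF.
    exact: small.
  apply: (@le_trans _ _ (th ^+ 2 / 2 * (1 - 1 / (3 * q%:R)))).
    by rewrite thE le_eqVlt; apply/orP; left; apply/eqP; field; rewrite gt_eqF.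
  by rewrite ler_wpM2l ?divr_ge0 ?sqr_ge0 //; lra.
have sumd : \sum_i \sum_j d i j ^+ 2 = 2 * (n%:R * M - A ^+ 2).
  rewrite (_ : \sum_i _ = \sum_i (n%:R * (l i)%:~R ^+ 2 + M - 2 * A * (l i)%:~R)); last first.
    apply: eq_bigr => i _.
    rewrite (_ : \sum_j _ = \sum_j ((l i)%:~R ^+ 2 + (l j)%:~R ^+ 2 - 2 * (l i)%:~R * (l j)%:~R)); last first.
      by apply: eq_bigr => j _; rewrite /d intrB; ring.
    rewrite sumrB big_split /= sumr_const card_ord -mulr_sumr -/M -/A -[_ *+ n]mulr_natl.
    ring.
  rewrite sumrB big_split /= sumr_const card_ord -!mulr_sumr -/M -/A -[M *+ n]mulr_natl.
  ring.
have V0 : 0 <= n%:R * M - A ^+ 2.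
  rewrite -(pmulr_rge0 _ (_ : 0 < 2)) // -sumd.
  by apply: sumr_ge0 => i _; apply: sumr_ge0 => j _; exact: sqr_ge0.
have hS : 2 * pi ^+ 2 / q%:R ^+ 2 * (1 - 1 / (3 * q%:R)) * (2 * (n%:R * M - A ^+ 2)) <= S.
  rewrite -sumd mulr_sumr; apply: ler_sum => i _; rewrite mulr_sumr.
  by apply: ler_sum => j _; exact: gap.
have nn : 0 < n%:R * (n%:R - 1) :> R by rewrite mulr_gt0; lra.
apply: (@le_trans _ _ (2 * t * (2 * pi ^+ 2 / q%:R ^+ 2 * (1 - 1 / (3 * q%:R)) *
   (2 * (n%:R * M - A ^+ 2)) / (n%:R * (n%:R - 1))))); last first.
  by rewrite ler_wpM2l ?mulr_ge0 ?t_ge0 // ler_wpM2r // invr_ge0 ltW.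
rewrite (_ : 2 * t * _ = (t * (1 - 1 / (3 * q%:R))) * (8 * pi ^+ 2 / (n%:R * q%:R ^+ 2)) *
   ((n%:R * M - A ^+ 2) / (n%:R - 1))); last by field; rewrite !gt_eqF //; lra.
rewrite tE (_ : _ * L / _ * _ = L); last by field; rewrite !gt_eqF //; lra.
rewrite ler_wpM2l // (_ : M - A ^+ 2 / n%:R = (n%:R * M - A ^+ 2) / n%:R); last first.
  by field; rewrite gt_eqF //; lra.
by rewrite ler_wpM2l // lef_pV2 ?posrE; lra.
Qed.

(** Both angles lie in [0, pi], where the cosine decreases; for the cutoff, 2 / sqrt q <= 2 <=
    pi. *)
Lemma wc_cutoff (z : int) : 2 * `|z| <= q%:Z -> cutoff <= wc z -> pi ^+ 2 * z%:~R ^+ 2 <= q%:R :> R.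
Proof.
have q1 := q1R; have n2 := nR; have p0 := pi_gt0 R.
move=> zq; rewrite /cutoff.
have -> : wc z = cos (2 * pi * `|z%:~R| / q%:R).
  rewrite /root_cos /angle -cos_norm; congr cos.
  by rewrite !normrM normfV (gtr0_norm p0) (gtr0_norm qR) normr_nat.
have zR : 2 * `|z%:~R| <= q%:R :> R.
  by move: zq; rewrite -(ler_int R) intrM -intr_norm.
have s1 : 1 <= Num.sqrt q%:R :> R by rewrite -[leLHS]sqrtr1 ler_sqrt.
have az : 0 <= `|z%:~R : R| by [].
move=> hcos; have : 2 * pi * `|z%:~R| / q%:R <= 2 / Num.sqrt q%:R :> R.
  rewrite leNgt; apply: contraTN hcos => h; rewrite -ltNge ltr_cos // in_itv /=.
  by rewrite divr_ge0 ?(ltW sq0) //= ler_pdivrMr //; apply: le_trans (ler_pM _ _ (pi_ge2 R) s1); rewrite ?mulr1.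
    by rewrite divr_ge0 ?mulr_ge0 ?(ltW p0) //= ler_pdivrMr // -mulrA mulrCA ler_pM2l.
rewrite ler_pdivlMr // mulrAC ler_pdivrMr // => h.
have h2 : pi * `|z%:~R| * Num.sqrt q%:R <= q%:R :> R.
  by rewrite -(ler_pM2l (_ : 0 < 2)) // !mulrA.
have h3 : pi * `|z%:~R| <= Num.sqrt q%:R :> R.
  by rewrite -(ler_pM2r sq0) -[leRHS]expr2 sqr_sqrtr ?ler0n.
rewrite -[z%:~R ^+ 2]real_normK ?num_real // -exprMn -[leRHS]sqr_sqrtr ?ler0n //.
by rewrite ler_sqr ?nnegrE ?sqrtr_ge0 // mulr_ge0 // ltW.
Qed.

End SpectralGap.

(** * Centred representatives of frequencies *)

Section Residues.
Variables (n q : nat).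
Hypothesis q_gt0 : (0 < q)%N.
Implicit Types (k : table n q) (u v : 'I_q).

Definition sres v : int := if (2 * v <= q)%N then (v : nat)%:Z else (v : nat)%:Z - q%:Z.

Lemma sres_congr v : (q%:Z %| sres v - (v : nat)%:Z)%Z.
Proof.
rewrite /sres; case: ifP => _; first by rewrite subrr.
by rewrite addrAC subrr add0r rpredN.
Qed.

Lemma sres_le v : 2 * `|sres v| <= q%:Z.
Proof. by rewrite /sres; have := ltn_ord v; case: ifP; lia. Qed.

Lemma sres_min v (z : int) : (q%:Z %| z - (v : nat)%:Z)%Z -> (`|sres v| <= `|z|)%N.
Proof.
move=> /dvdzP [c e]; have {e} -> : z = c * q%:Z + (v : nat)%:Z by rewrite -e subrK.
have vq := ltn_ord v; rewrite /sres.
have [c0|[c0|->]] : (1 <= c) \/ (c <= -1) \/ c = 0 by lia.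
- have h : q%:Z <= c * q%:Z by nia.
  by case: ifP; lia.
- have h : c * q%:Z <= - q%:Z by nia.
  by case: ifP; lia.
- by case: ifP; lia.
Qed.

Lemma sres_eq0 v : (sres v == 0) = (v == 0%N :> nat).
Proof. by rewrite /sres; have := ltn_ord v; case: ifP; lia. Qed.

Definition sqnorm k : nat := \sum_i `|sres (k i)| ^ 2.

(** Adding a constant preserves all differences modulo [q], hence the eigenvalue. *)
Definition tshift v k : table n q := [ffun i => Ordinal (ltn_pmod (k i + v) q_gt0)].

Lemma shift_congr v k i : (q%:Z %| (tshift v k i : nat)%:Z - ((k i : nat)%:Z + (v : nat)%:Z))%Z.
Proof. by rewrite ffunE /= -eqz_mod_dvd -PoszD !modz_nat modn_mod. Qed.

Lemma shift_inj v : injective (tshift v).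
Proof.
move=> k l /ffunP h; apply/ffunP => i; apply/val_inj.
have := h i; rewrite !ffunE => /(congr1 val) /= /eqP.
by rewrite eqn_modDr !modn_small // => /eqP.
Qed.

Lemma shift_diff v k i j :
  (q%:Z %| freq (tshift v k) i - freq (tshift v k) j - (freq k i - freq k j))%Z.
Proof.
rewrite /freq (_ : _ - _ = ((tshift v k i : nat)%:Z - ((k i : nat)%:Z + (v : nat)%:Z)) -
  ((tshift v k j : nat)%:Z - ((k j : nat)%:Z + (v : nat)%:Z))); last by ring.
by apply: rpredB; exact: shift_congr.
Qed.

Lemma sqnorm_shift_le v k (z : 'I_n -> int) :
  (forall i, (q%:Z %| z i - ((k i : nat)%:Z + (v : nat)%:Z))%Z) ->
  (sqnorm (tshift v k) <= \sum_i `|z i| ^ 2)%N.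
Proof.
move=> h; apply: leq_sum => i _; rewrite leq_sqr; apply: sres_min.
rewrite (_ : z i - _ = (z i - ((k i : nat)%:Z + (v : nat)%:Z)) -
  ((tshift v k i : nat)%:Z - ((k i : nat)%:Z + (v : nat)%:Z))); last by ring.
by apply: rpredB => //; exact: shift_congr.
Qed.

(** Least squared norm in the shift orbit. An orbit may have several reduced members, which is
    harmless for an upper bound. *)
Definition reduced k := [forall v, (sqnorm k <= sqnorm (tshift v k))%N].

Lemma shift_shift u v k : exists w, tshift u (tshift v k) = tshift w k.
Proof.
exists (Ordinal (ltn_pmod (u + v) q_gt0)); apply/ffunP => i; apply/val_inj.
by rewrite !ffunE /= modnDml modnDmr addnAC -addnA (addnC u).
Qed.

Lemma ex_reduced k : exists v, reduced (tshift v k).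
Proof.
case: (@arg_minnP _ (Ordinal q_gt0) predT (fun v => sqnorm (tshift v k)) isT) => v _ hv.
exists v; apply/forallP => u; have [w ->] := shift_shift u v k.
exact: hv.
Qed.

Lemma ex_shift_by (c : int) : exists v : 'I_q, (q%:Z %| c - (v : nat)%:Z)%Z.
Proof.
have qz : 0 < q%:Z by lia.
have h0 := modz_ge0 c (lt0r_neq0 qz); have h1 := ltz_pmod c qz.
have h : (`|(c %% q)%Z| < q)%N by lia.
exists (Ordinal h) => /=; rewrite gez0_abs //.
by rewrite -eqz_mod_dvd modz_mod.
Qed.

(* sres (k i) + c may leave the centred range, but by sres_min reducing it again
   only makes it smaller. *)
Lemma reduced_step k (c : int) : `|c| = 1 -> reduced k ->
  0 <= 2 * c * (\sum_i sres (k i)) + n%:Z.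
Proof.
move=> c1 /forallP red; have [v hv] := ex_shift_by c.
have := leq_trans (red v) (@sqnorm_shift_le v k (fun i => sres (k i) + c) _).
rewrite /sqnorm => /(_ _) h.
have {h} : (\sum_i `|sres (k i)| ^ 2 <= \sum_i `|(sres (k i) + c)%R| ^ 2)%N.
  apply: h => i; rewrite opprD addrACA; apply: rpredD => //; exact: sres_congr.
rewrite -lez_nat !(big_morph Posz PoszD erefl) => h.
have e : \sum_i (`|(sres (k i) + c)%R| ^ 2)%N%:Z = \sum_i (`|sres (k i)| ^ 2)%N%:Z + (2 * c * (\sum_i sres (k i)) + n%:Z).
  have -> : n%:Z = \sum_(i < n) 1 by rewrite sumr_const card_ord -mulr_natr mul1r natz.
  rewrite mulr_sumr -!big_split; apply: eq_bigr => i _ /=.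
  by lia.
by move: h; rewrite e lerDl.
Qed.

End Residues.

(** * Restriction of the heat sum to reduced frequencies *)

Section ReducedSum.
Variables (R : realType) (n q : nat).
Hypotheses (n_gt1 : (1 < n)%N) (q_gt0 : (0 < q)%N).
Implicit Types (k : table n q).
Local Notation wc := (root_cos R q).
Local Notation heat := (@heat_coef R n q).
Local Notation tshift := (tshift q_gt0).
Local Notation reduced := (reduced q_gt0).
Local Notation cutoff := (cutoff R q).
Variables (L t : R).
Hypotheses (L_ge0 : 0 <= L)
  (tE : t * (1 - 1 / (3 * q%:R)) = n%:R * q%:R ^+ 2 * L / (8 * pi ^+ 2)).

Definition near_diag k := [forall i, forall j, cutoff <= wc (freq k i - freq k j)].

(** Bound for a reduced frequency of squared norm m: its sum A satisfies |A| <= m and |A| <= n / 2,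
    so A^2 <= m min (m, n / 2). *)
Definition gauss_weight (m : nat) : R :=
  expR (- (L * (m%:R - m%:R * Num.min m%:R (n%:R / 2) / n%:R))).
Local Notation weight := gauss_weight.

Lemma sqnormR k : (sqnorm k)%:R = \sum_i (sres (k i))%:~R ^+ 2 :> R.
Proof.
rewrite /sqnorm natr_sum; apply: eq_bigr => i _.
by rewrite natrX -[RHS]real_normK ?num_real // -intr_norm -abszE -pmulrn.
Qed.

Lemma reduced_sum_le k : reduced k -> `|\sum_i (sres (k i))%:~R| <= n%:R / 2 :> R.
Proof.
move=> rk; rewrite -rmorph_sum /=.
have h1 := reduced_step (c := 1) erefl rk; have h2 := reduced_step (c := -1) erefl rk.
set A := \sum_i _ in h1 h2 *.
have h : 2 * `|A| <= n%:Z by lia.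
by move: h; rewrite -(ler_int R) intrM intr_norm -pmulrn; lra.
Qed.

(* Minimality bounds the sum of squares by n q / 4, so each residue is below
   q / 4 and the differences do not wrap around. *)
Lemma near_diag_sres k : (4 * n < q)%N -> near_diag k -> reduced k ->
  forall i j, pi ^+ 2 * (sres (k i) - sres (k j))%:~R ^+ 2 <= q%:R :> R.
Proof.
move=> nq /forallP nd /forallP rk.
have nd' i j (z : int) : (q%:Z %| freq k i - freq k j - z)%Z -> 2 * `|z| <= q%:Z ->
    pi ^+ 2 * z%:~R ^+ 2 <= q%:R :> R.
  move=> h zq; apply: (wc_cutoff n_gt1) => //.
  by have /forallP /(_ j) := nd i; rewrite (wc_congr _ q_gt0 h).
pose i0 := Ordinal (ltnW n_gt1).
(* Moving coordinate [i0] to 0 turns every entry into a difference, which [near_diag] controls. *)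
have [v hv] := ex_shift_by q_gt0 (- freq k i0).
pose l i := sres (tshift v k i).
have lE i : (q%:Z %| freq k i - freq k i0 - l i)%Z.
  rewrite (_ : _ - l i = (- freq k i0 - (v : nat)%:Z) - (l i - (tshift v k i : nat)%:Z)
    - ((tshift v k i : nat)%:Z - (freq k i + (v : nat)%:Z))); last by ring.
  apply: rpredB; last exact: shift_congr.
  by apply: rpredB => //; exact: sres_congr.
have l4 i : 4 * (`|l i| ^ 2)%N%:Z <= q%:Z.
  have := nd' i i0 (l i) (lE i) (sres_le q_gt0 _).
  have p4 : 4 <= pi ^+ 2 :> R by have := pi_ge2 R; nra.
  rewrite -(ler_int R) intrM -!pmulrn natrX => h.
  have -> : `|l i|%:R ^+ 2 = (l i)%:~R ^+ 2 :> R.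
    by rewrite -[RHS]real_normK ?num_real // -intr_norm -abszE -pmulrn.
  have := sqr_ge0 ((l i)%:~R : R); nra.
have M4 : (4 * sqnorm k <= n * q)%N.
  apply: leq_trans (_ : 4 * sqnorm (tshift v k) <= _)%N; first by rewrite leq_mul2l rk orbT.
  have -> : (n * q = \sum_(i < n) q)%N by rewrite sum_nat_const card_ord.
  rewrite /sqnorm big_distrr /=; apply: leq_sum => i _; exact: l4 i.
have l2 i : 4 * `|sres (k i)| < q%:Z.
  have h : (`|sres (k i)| ^ 2 <= sqnorm k)%N by rewrite /sqnorm (bigD1 i) //= leq_addr.
  (* By [M4] the left side is at most 4 n q, and 4 n < q. *)
  have : (16 * `|sres (k i)| ^ 2 < q * q)%N by nia.
  nia.
move=> i j; apply: (nd' i j); last by have := l2 i; have := l2 j; lia.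
rewrite /freq (_ : _ - (_ - _) = (sres (k j) - (k j : nat)%:Z) - (sres (k i) - (k i : nat)%:Z)); last by ring.
by apply: rpredB; exact: sres_congr.
Qed.

Lemma heat_reduced_le k : (4 * n < q)%N -> near_diag k -> reduced k ->
  heat (2 * t) (freq k) <= weight (sqnorm k).
Proof.
move=> nq nd rk.
have nR : 0 < n%:R :> R by rewrite ltr0n ltnW.
apply: le_trans (heat_near n_gt1 q_gt0 L_ge0 tE (l := fun i => sres (k i)) _ _) _.
- move=> i j; rewrite /freq (_ : _ - (_ - _) = (sres (k j) - (k j : nat)%:Z) - (sres (k i) - (k i : nat)%:Z)); last by ring.
  by apply: rpredB; exact: sres_congr.
- exact: near_diag_sres.
rewrite -sqnormR /gauss_weight ler_expR lerN2 ler_wpM2l // lerD2l lerN2 ler_pM2r ?invr_gt0 //.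
have := reduced_sum_le rk; set A := \sum_i _ => hA.
have AM : `|A| <= (sqnorm k)%:R.
  rewrite sqnormR; apply: le_trans (ler_norm_sum _ _ _) _; apply: ler_sum => i _.
  rewrite -[leRHS]real_normK ?num_real // -intr_norm -rmorphXn /= ler_int.
  by nia.
rewrite -[A ^+ 2]real_normK ?num_real // expr2; apply: ler_pM => //.
by rewrite le_min AM hA.
Qed.

Lemma heat_shift_freq v k : heat (2 * t) (freq (tshift v k)) = heat (2 * t) (freq k).
Proof.
rewrite /heat_coef /eigenvalue; congr (expR (- (_ * (1 - _)))).
apply: eq_bigr => i _; apply: eq_bigr => j _; congr (_ / _).
by apply: wc_congr => //; exact: shift_diff.
Qed.

Lemma near_diag_shift v k : near_diag (tshift v k) = near_diag k.
Proof.
apply: eq_forallb => i; apply: eq_forallb => j; congr (_ <= _).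
by apply: wc_congr => //; exact: shift_diff.
Qed.

Lemma nonconst_shift v k : nonconst (tshift v k) = nonconst k.
Proof.
apply: eq_existsb => i; apply: eq_existsb => j; congr (~~ _).
by rewrite !ffunE -val_eqE /= eqn_modDr !modn_small // val_eqE.
Qed.

Lemma nonconst_sqnorm k : nonconst k -> (0 < sqnorm k)%N.
Proof.
apply: contraTT; rewrite -leqNgt leqn0 sum_nat_eq0 => /forallP h.
have h0 i : k i = 0%N :> nat.
  by have := h i; rewrite implyTb expn_eq0 andbT absz_eq0 (sres_eq0 q_gt0) => /eqP.
by apply/existsPn => i; apply/existsPn => j; rewrite negbK -val_eqE /= !h0.
Qed.

(** Far frequencies, at most q^n of them, are bounded uniformly. Each near one is charged to a shift
    that reduces it; the q possible shifts cancel the factor 1 / q. *)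
Lemma heat_sum_le : (4 * n < q)%N ->
  q%:R^-1 * \sum_(k : table n q | nonconst k) heat (2 * t) (freq k) <=
  (q ^ n)%:R * expR (- (q%:R * L / 64)) + \sum_(k : table n q | (0 < sqnorm k)%N) weight (sqnorm k).
Proof.
move=> nq.
have qR : 1 <= q%:R :> R by rewrite ler1n.
have q0 : 0 < q%:R :> R by rewrite ltr0n.
rewrite (bigID near_diag) /= mulrDr addrC; apply: lerD.
  apply: (@le_trans _ _ (\sum_(k : table n q | nonconst k && ~~ near_diag k) heat (2 * t) (freq k))).
    by rewrite ler_piMl ?invf_le1 // sumr_ge0 // => k _; exact: expR_ge0.
  apply: (@le_trans _ _ (\sum_(k : table n q | nonconst k && ~~ near_diag k) expR (- (q%:R * L / 64)))).
    apply: ler_sum => k /andP [_ /forallPn [i /forallPn [j]]]; rewrite -ltNge => far.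
    apply: (heat_far n_gt1 q_gt0 L_ge0 tE _ far).
    apply/eqP => ij; move: far; rewrite ij subrr wc0 ltNge cos_le1 //.
  have -> : (q ^ n)%:R * expR (- (q%:R * L / 64)) = \sum_(k : table n q) expR (- (q%:R * L / 64)).
    by rewrite sumr_const card_ffun !card_ord mulr_natl.
  rewrite [leRHS](bigID (fun k => nonconst k && ~~ near_diag k)) /= lerDl.
  by apply: sumr_ge0 => k _; exact: expR_ge0.
rewrite -(ler_pM2l q0) mulrA divff ?gt_eqF // mul1r.
pose G k := nonconst k && near_diag k.
apply: (@le_trans _ _ (\sum_(k : table n q) \sum_(v : 'I_q) if G (tshift v k) && reduced (tshift v k) then heat (2 * t) (freq (tshift v k)) else 0)).
  rewrite [leRHS](bigID G) /= -[leLHS]addr0; apply: lerD; last first.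
    by apply: sumr_ge0 => k _; apply: sumr_ge0 => v _; case: ifP => // _; exact: expR_ge0.
  apply: ler_sum => k Gk; have [v rv] := ex_reduced q_gt0 k.
  have Gv : G (tshift v k) by rewrite /G nonconst_shift near_diag_shift.
  rewrite (bigD1 v) //= Gv rv /= heat_shift_freq lerDl.
  by apply: sumr_ge0 => w _; case: ifP => // _; exact: expR_ge0.
rewrite exchange_big /=.
have -> : q%:R * \sum_(k : table n q | (0 < sqnorm k)%N) weight (sqnorm k) =
   \sum_(v < q) \sum_(k : table n q | (0 < sqnorm k)%N) weight (sqnorm k).
  by rewrite sumr_const card_ord mulr_natl.
apply: ler_sum => v _.
pose f k := if G k && reduced k then heat (2 * t) (freq k) else 0.
rewrite -[leLHS]/(\sum_k f (tshift v k)) -(reindex_inj (@shift_inj _ _ q_gt0 v) (P := xpredT) (F := f)) -big_mkcond /=.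
apply: (@le_trans _ _ (\sum_(k | G k && reduced k) weight (sqnorm k))).
  by apply: ler_sum => k /andP [/andP [_ nd] rk]; exact: heat_reduced_le.
rewrite [leRHS](bigID (fun k => G k && reduced k)) /= -[leLHS]addr0; apply: lerD.
  rewrite le_eqVlt; apply/orP; left; apply/eqP; apply: eq_bigl => k.
  by case: (boolP (G k)) => [/andP [/nonconst_sqnorm -> _]|_] //=; rewrite andbF.
by apply: sumr_ge0 => k _; exact: expR_ge0.
Qed.

End ReducedSum.

(** * Counting frequencies by squared norm *)

Lemma geometric_sum_le (R : realFieldType) (u : R) (m : nat) : 0 <= u < 1 ->
  \sum_(j < m) u ^+ j.+1 <= u / (1 - u).
Proof.
move=> /andP [u0 u1]; under eq_bigr do rewrite exprS.
have d0 : 0 < 1 - u by rewrite subr_gt0.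
rewrite -mulr_sumr ler_wpM2l // -[_^-1]mul1r ler_pdivlMr //.
have := subrX1 u m; have := exprn_ge0 m u0.
set S := \sum_(i < m) _; nra.
Qed.

(** From e^(-1/24) >= 23/24, four squarings with decimals rounded down give e^(-2/3) >= 1/2. *)
Lemma ln2_ge (R : realType) : 2 / 3 <= ln 2 :> R.
Proof.
rewrite -ler_expR lnK ?posrE // -[2 / 3]opprK expRN invf_ple ?posrE ?expR_gt0 //.
have -> : - (2 / 3) = 16%:R * (- 24^-1) :> R by lra.
rewrite expRM_natl; set x := expR _.
have x1 : 23 / 24 <= x by apply: le_trans (expR_ge1Dx _); lra.
have x2 : 918 / 1000 <= x ^+ 2 by nra.
have x4 : 842 / 1000 <= x ^+ 4 by rewrite (exprM x 2 2); nra.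
have x8 : 708 / 1000 <= x ^+ 8 by rewrite (exprM x 4 2); nra.
have : 1 / 2 <= x ^+ 16 by rewrite (exprM x 8 2); nra.
lra.
Qed.

Section GeneratingFunction.
Variables (R : realType) (n q : nat).
Hypothesis q_gt0 : (0 < q)%N.

(** As |z|^2 >= |z| for integers, the term of v <> 0 is at most y^v or y^(q - v), and both families
    are geometric. *)
Lemma sum_sres_le (y : R) : 0 <= y < 1 ->
  \sum_(v < q) y ^+ (`|sres v| ^ 2)%N <= 1 + 2 * (y / (1 - y)).
Proof.
move=> /andP [y0 y1].
have step (v : 'I_q) : (0 < v)%N -> y ^+ (`|sres v| ^ 2)%N <= y ^+ v + y ^+ (q - v)%N.
  move=> v0; have vq := ltn_ord v.
  have mono a b : (a <= b)%N -> y ^+ b <= y ^+ a by move=> ab; rewrite ler_wiXn2l // ltW.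
  have p0 a : 0 <= y ^+ a by exact: exprn_ge0.
  rewrite /sres; case: ifP => h.
    apply: le_trans (mono v _ _) _; first nia.
    by rewrite lerDl.
  apply: le_trans (mono (q - v)%N _ _) _; first nia.
  by rewrite lerDr.
case: q q_gt0 step => [//|p] _ step.
rewrite big_ord_recl (_ : `|sres ord0| = 0)%N // expr0 lerD2l.
apply: (@le_trans _ _ (\sum_(v < p) (y ^+ v.+1 + y ^+ (p - v)%N))).
  by apply: ler_sum => v _; apply: le_trans (step _ _) _ => //; rewrite lift0 subSS.
rewrite big_split /= [X in _ + X](reindex_inj rev_ord_inj) /=.
rewrite [X in _ + X](eq_bigr (fun v : 'I_p => y ^+ v.+1)).
  have := @geometric_sum_le _ y p; rewrite y0 y1 => /(_ isT); lra.
by move=> v _; congr (_ ^+ _); have := ltn_ord v; lia.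
Qed.

(** The sum over tables factorises over the coordinates, and 1 + u <= e^u. *)
Lemma gen_fun_le (y : R) : 0 <= y < 1 ->
  \sum_(k : table n q) y ^+ sqnorm k <= expR (n%:R * (2 * (y / (1 - y)))).
Proof.
move=> hy; have /andP [y0 y1] := hy.
have -> : \sum_(k : table n q) y ^+ sqnorm k = (\sum_(v < q) y ^+ (`|sres v| ^ 2)%N) ^+ n.
  rewrite -[n in RHS]card_ord -prodr_const bigA_distr_bigA /=; apply: eq_bigr => k _.
  by rewrite /sqnorm (big_morph _ (exprD y) (expr0 y)).
rewrite expRM_natl lerXn2r ?nnegrE ?expR_ge0 //; first by apply: sumr_ge0 => v _; exact: exprn_ge0.
by apply: le_trans (sum_sres_le hy) _; exact: expR_ge1Dx.
Qed.

Variables (L : R) (Z : nat).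
Hypotheses (n_gt0 : (0 < n)%N) (Z_gt1 : (1 < Z)%N).
Local Notation weight := (gauss_weight n L).

(** The weight is at most exp (- L m / 2). Half of this exponent becomes y^m in the generating
    function, which costs at most exp (2 n) since y <= 1/2; the other half gives exp (- 3 n),
    because m > n / Z and L >= 12 Z. *)
Lemma weight_tail_le : 4 <= L -> 12 * Z%:R <= L ->
  \sum_(k : table n q | (n < sqnorm k * Z)%N) weight (sqnorm k) <= expR (- n%:R).
Proof.
move=> L4 LZ; pose y := expR (- (L / 4)).
have y2 : 0 <= y <= 2^-1.
  rewrite expR_ge0 /= /y expRN lef_pV2 ?posrE ?expR_gt0 //.
  by apply: le_trans (expR_ge1Dx _); lra.
have nR : 0 < n%:R :> R by rewrite ltr0n.
have ZR : 0 < Z%:R :> R by rewrite ltr0n ltnW.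
apply: (@le_trans _ _ (\sum_(k : table n q) expR (- (L * n%:R / (4 * Z%:R))) * y ^+ sqnorm k)).
  rewrite [leRHS](bigID (fun k => (n < sqnorm k * Z)%N)) /= -[leLHS]addr0; apply: lerD; last first.
    by apply: sumr_ge0 => k _; rewrite mulr_ge0 ?expR_ge0 ?exprn_ge0 // expR_ge0.
  apply: ler_sum => k; rewrite /gauss_weight; move: (sqnorm k) => m nm.
  have nmR : n%:R < m%:R * Z%:R :> R by rewrite -natrM ltr_nat.
  rewrite /y -expRM_natl -expRD ler_expR.
  have h1 : m%:R * Num.min m%:R (n%:R / 2) / n%:R <= m%:R / 2 :> R.
    rewrite -mulrA ler_wpM2l // ler_pdivrMr // [_ * n%:R]mulrC ge_min lexx orbT //.
  have h2 : L * n%:R / (4 * Z%:R) <= L * m%:R / 4.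
    rewrite ler_pdivrMr ?mulr_gt0 // (_ : L * m%:R / 4 * (4 * Z%:R) = L * (m%:R * Z%:R)); last by field.
    by rewrite ler_wpM2l ?ltW //; lra.
  have h3 : L * (m%:R / 2) <= L * (m%:R - m%:R * Num.min m%:R (n%:R / 2) / n%:R).
    by rewrite ler_wpM2l; lra.
  lra.
rewrite -mulr_sumr.
apply: (@le_trans _ _ (expR (- (L * n%:R / (4 * Z%:R))) * expR (n%:R * 2))).
  rewrite ler_wpM2l ?expR_ge0 //; apply: le_trans (gen_fun_le _) _; first lra.
  rewrite ler_expR ler_wpM2l //; have : y / (1 - y) <= 1 by rewrite ler_pdivrMr; lra.
  lra.
rewrite -expRD ler_expR.
suff : 3 * n%:R <= L * n%:R / (4 * Z%:R) by lra.
by rewrite ler_pdivlMr ?mulr_gt0 //; nra.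
Qed.

(** At most (2 n / j)^j e^(4 j / 3) tables have squared norm j, and their weight is at most (a
    n)^(-j) (2 j)^j by the last hypothesis. The product is (4 e^(4/3) / a)^j, and e^(4/3) <= 4. *)
Lemma weight_head_le (a : R) :
  16 < a -> L = ln (a * n%:R) ->
  (forall m : nat, (0 < m)%N -> (m * Z <= n)%N -> L * m%:R / n%:R <= ln (2 * m%:R)) ->
  \sum_(k : table n q | (0 < sqnorm k)%N && (sqnorm k * Z <= n)%N) weight (sqnorm k)
    <= 16 / a / (1 - 16 / a).
Proof.
move=> a16 LE hL.
have nR : 0 < n%:R :> R by rewrite ltr0n.
have u01 : 0 <= 16 / a < 1 by rewrite divr_ge0 ?ltr_pdivrMr //; lra.
apply: le_trans (geometric_sum_le n u01).
have lemn (m : nat) : (m * Z <= n)%N -> (m <= n)%N by move=> h; nia.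
rewrite (partition_big (fun k => inord (sqnorm k) : 'I_n.+1) (fun j : 'I_n.+1 => (0 < j)%N && (j * Z <= n)%N)) /=; last first.
  by move=> k /andP [k0 kZ]; rewrite inordK ?ltnS; [rewrite k0 kZ|exact: lemn].
apply: (@le_trans _ _ (\sum_(j < n.+1 | (0 < j)%N && (j * Z <= n)%N) (16 / a) ^+ j)); last first.
  rewrite big_mkcond big_ord_recl /= add0r; apply: ler_sum => j _; case: ifP => // _.
  by rewrite exprn_ge0 //; case/andP: u01.
apply: ler_sum => j /andP [j0 jZ].
have jn := lemn _ jZ.
have jR : 0 < j%:R :> R by rewrite ltr0n.
have j2 : 2 * j%:R <= n%:R :> R by rewrite -natrM ler_nat; nia.
(* Chernoff bound for the number of tables with sqnorm equal to j. *)
pose y : R := j%:R / (2 * n%:R).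
have y4 : 0 < y <= 4^-1.
  by rewrite /y divr_gt0 ?mulr_gt0 //= ler_pdivrMr ?mulr_gt0 //; lra.
apply: (@le_trans _ _ (\sum_(k : table n q) weight j / y ^+ j * y ^+ sqnorm k)).
  rewrite [leRHS](bigID (fun k => [&& (0 < sqnorm k)%N, (sqnorm k * Z <= n)%N & inord (sqnorm k) == j])) /= -[leLHS]addr0; apply: lerD; last first.
    by apply: sumr_ge0 => k _; rewrite mulr_ge0 ?divr_ge0 ?expR_ge0 ?exprn_ge0 //; lra.
  rewrite le_eqVlt; apply/orP; left; apply/eqP; apply: eq_big => [k|k]; first by rewrite andbA.
  move=> /andP [/andP [k0 kZ] /eqP kj].
  have -> : sqnorm k = j by rewrite -kj inordK // ltnS; exact: lemn.
  by rewrite divfK // expf_neq0 // gt_eqF //; lra.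
rewrite -mulr_sumr.
apply: (@le_trans _ _ (weight j / y ^+ j * expR (n%:R * (2 * (y / (1 - y)))))).
  rewrite ler_wpM2l ?divr_ge0 ?expR_ge0 ?exprn_ge0 //; first lra.
  by apply: gen_fun_le; lra.
have h1 : n%:R * (2 * (y / (1 - y))) <= j%:R * (4 / 3).
  rewrite (_ : n%:R * _ = j%:R / (1 - y)); last first.
    have -> : n%:R = j%:R / (2 * y) by rewrite /y; field; rewrite !gt_eqF.
    by field; rewrite !gt_eqF //; lra.
  rewrite ler_wpM2l ?ler0n // -[4 / 3]invrK lef_pV2 ?posrE //; lra.
have h2 := hL j j0 jZ.
have a0 : 0 < a by lra.
have ye : y ^+ j = expR (j%:R * ln y) by rewrite expRM_natl lnK // posrE; lra.
have ae : (16 / a) ^+ j = expR (j%:R * (ln 16 - ln a)).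
  by rewrite expRM_natl -ln_div ?posrE // lnK // posrE divr_gt0.
rewrite /gauss_weight ye ae -expRN -!expRD ler_expR.
have -> : Num.min j%:R (n%:R / 2) = j%:R :> R by apply/min_idPl; lra.
have lny : ln y = ln j%:R - ln 2 - ln n%:R.
  by rewrite /y ln_div ?posrE ?mulr_gt0 // lnM ?posrE // opprD addrA.
have l2 : ln (2 * j%:R) = ln 2 + ln j%:R :> R by rewrite lnM ?posrE.
have l16 : ln 16 = ln 2 *+ 4 :> R by rewrite -lnXn // -natrX.
have l2ge := ln2_ge R.
have LE' : L = ln a + ln n%:R by rewrite LE lnM ?posrE.
suff : - (L * (1 - j%:R / n%:R)) - ln y + 4 / 3 <= ln 16 - ln a.
  move=> h.
  have : j%:R * (- (L * (1 - j%:R / n%:R)) - ln y + 4 / 3) <= j%:R * (ln 16 - ln a) by rewrite ler_wpM2l // ltW.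
  move: h1; lra.
move: h2; rewrite l2 lny l16 LE' -mulr_natr; lra.
Qed.

End GeneratingFunction.

(** * The threshold alpha and the asymptotics *)

Lemma expR1_le3 (R : realType) : expR 1 <= 3 :> R.
Proof.
rewrite -[1]opprK expRN invf_ple ?posrE ?expR_gt0 //.
have -> : - 1 = 8%:R * (- 8^-1) :> R by lra.
rewrite expRM_natl; set x := expR _.
have x1 : 7 / 8 <= x by apply: le_trans (expR_ge1Dx _); lra.
have x2 : 765 / 1000 <= x ^+ 2 by nra.
have x4 : 585 / 1000 <= x ^+ 4 by rewrite (exprM x 2 2); nra.
have : 342 / 1000 <= x ^+ 8 by rewrite (exprM x 4 2); nra.
lra.
Qed.

Lemma expR2_ge5 (R : realType) : 5 <= expR 2 :> R.
Proof.
have -> : 2 = 4%:R * 2^-1 :> R by lra.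
rewrite expRM_natl; set x := expR _.
have x1 : 3 / 2 <= x by apply: le_trans (expR_ge1Dx _); lra.
have x2 : 9 / 4 <= x ^+ 2 by nra.
by rewrite (exprM x 2 2); nra.
Qed.

Section Alpha.
Variables (R : realType) (eps : R).
Hypothesis eps01 : 0 < eps < 1.
Local Notation C := (4 + 4 * expR (2 / expR 1) : R).
Local Notation alpha := (dg_alpha eps).

Lemma alpha_const_ge : 32 / 3 <= C.
Proof.
suff : 5 / 3 <= expR (2 / expR 1) :> R by lra.
apply: le_trans (expR_ge1Dx _).
suff : 2 / 3 <= 2 / expR 1 :> R by lra.
by rewrite ler_wpM2l // lef_pV2 ?posrE ?expR_gt0 // expR1_le3.
Qed.

(** The defining condition means z >= (C / log (1 + 4 eps^2))^2, so the infimum is attained at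
    [a0]. *)
Lemma dg_alpha_mem : 1 <= alpha /\ expR (C / Num.sqrt alpha) - 1 <= 4 * eps ^+ 2.
Proof.
have /andP [e0 e1] := eps01.
have C0 : 0 < C by have := alpha_const_ge; lra.
pose l := ln (1 + 4 * eps ^+ 2).
have E1 : 1 < 1 + 4 * eps ^+ 2 by rewrite ltrDl mulr_gt0 ?exprn_gt0.
have l0 : 0 < l by rewrite ln_gt0.
pose a0 := Num.max 1 ((C / l) ^+ 2).
have memE z : 1 <= z -> (expR (C / Num.sqrt z) - 1 <= 4 * eps ^+ 2) = ((C / l) ^+ 2 <= z).
  move=> z1; have sz : 0 < Num.sqrt z by rewrite sqrtr_gt0; lra.
  have z0 : 0 <= z by lra.
  rewrite lerBlDl -[X in _ <= X]lnK ?posrE; last by lra.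
  rewrite ler_expR -/l ler_pdivrMr // [l * _]mulrC -ler_pdivrMr //.
  by rewrite -[z in RHS]sqr_sqrtr // ler_sqr ?nnegrE ?sqrtr_ge0 ?divr_ge0 ?(ltW C0) ?(ltW l0).
have a01 : 1 <= a0 by rewrite le_max lexx.
have a02 : expR (C / Num.sqrt a0) - 1 <= 4 * eps ^+ 2 by rewrite memE // le_max lexx orbT.
suff -> : alpha = a0 by split.
rewrite /dg_alpha; apply/eqP; rewrite eq_le; apply/andP; split.
  by apply: ge_inf; [exists 1 => z []|split].
apply: lb_le_inf; first by exists a0; split.
by move=> z [z1]; rewrite memE // => hz; rewrite /a0 ge_max z1.
Qed.

(** With x = alpha^(-1/2), exp (C x) <= 1 + 4 eps^2 < 5 <= e^2 gives C x < 2, hence x < 3/16. Then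
    16 x^2 / (1 - 16 x^2) <= C x <= exp (C x) - 1. *)
Lemma dg_alpha_spec : 16 < alpha /\ 16 / alpha / (1 - 16 / alpha) <= 4 * eps ^+ 2.
Proof.
have /andP [e0 e1] := eps01.
have [a1 ha] := dg_alpha_mem; have C1 := alpha_const_ge.
have sa : 0 < Num.sqrt alpha by rewrite sqrtr_gt0; lra.
set x := (Num.sqrt alpha)^-1 in ha *.
have x0 : 0 < x by rewrite invr_gt0.
have ax : alpha^-1 = x ^+ 2 by rewrite /x exprVn sqr_sqrtr //; lra.
have Cx : C * x < 2.
  rewrite -ltr_expR; apply: lt_le_trans (expR2_ge5 R).
  by apply: le_lt_trans (_ : 1 + 4 * eps ^+ 2 < _); [lra|nra].
have x3 : x < 3 / 16 by nra.
have x9 : x ^+ 2 < 9 / 256 by nra.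
split.
  rewrite -[alpha]invrK ax -[16]invrK ltf_pV2 ?posrE ?exprn_gt0 //; lra.
apply: le_trans ha; apply: (@le_trans _ _ (C * x)); last first.
  by have := expR_ge1Dx (C * x); lra.
rewrite ax ler_pdivrMr; last lra.
nra.
Qed.

End Alpha.

(** With z = n / m >= Z, the claim is log a + log z + log m <= z log 2 + z log m. Since log z <= z /
    4 + log 4 and log (4 a) <= z / 4, the first two terms cost at most z / 2, while log 2 >= 2/3. *)
Lemma head_condition (R : realType) (a : R) (n Z m : nat) :
  1 <= a -> (1 < Z)%N -> 4 * ln (4 * a) <= Z%:R -> (0 < m)%N -> (m * Z <= n)%N ->
  ln (a * n%:R) * m%:R / n%:R <= ln (2 * m%:R).
Proof.
move=> a1 Z1 hZ m0 mZ.
have mR : 1 <= m%:R :> R by rewrite ler1n.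
have nR : 0 < n%:R :> R by rewrite ltr0n; nia.
pose z : R := n%:R / m%:R.
have Zz : Z%:R <= z by rewrite ler_pdivlMr ?(lt_le_trans _ mR) // -natrM ler_nat mulnC.
have Z2 : 2 <= Z%:R :> R by rewrite ler_nat.
have nE : n%:R = z * m%:R by rewrite divfK // gt_eqF //; lra.
clearbody z.
have z0 : 0 < z by lra.
have m0' : 0 < m%:R :> R by lra.
have a0 : 0 < a by lra.
have -> : ln (a * n%:R) * m%:R / n%:R = ln (a * n%:R) / z.
  by rewrite nE; field; rewrite !gt_eqF.
rewrite nE ler_pdivrMr // !lnM ?posrE ?mulr_gt0 //.
have lz : ln z <= z / 4 + ln 4.
  have := ln_sublinear (_ : 0 < z / 4); rewrite ln_div ?posrE // => /(_ _) h.
  have : ln z - ln 4 < z / 4 by apply: h; rewrite divr_gt0.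
  lra.
have la : ln 4 + ln a <= z / 4 by move: hZ; rewrite lnM ?posrE //; lra.
have lm : 0 <= ln m%:R :> R by rewrite ln_ge0.
have h1 : ln m%:R <= ln m%:R * z by rewrite ler_peMr //; lra.
have h2 : 2 / 3 * z <= ln 2 * z by rewrite ler_wpM2r ?(ltW z0) // ln2_ge.
by rewrite [leRHS]mulrDl; lra.
Qed.

Local Open Scope classical_set_scope.
Local Open Scope ring_scope.

(** * Both bounds under explicit thresholds on n and q *)

Section Asymptotics.
Variable R : realType.

Lemma ln_natr_near (c : R) : \forall n \near \oo, c <= ln n%:R.
Proof.
near=> n.
have h : expR c <= n%:R by near: n; exact: nbhs_infty_ger.
rewrite -[c]expRK ler_ln ?posrE ?expR_gt0 //.
by apply: lt_le_trans h; exact: expR_gt0.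
Unshelve. all: by end_near. Qed.

Lemma ratio_near (q : nat -> nat) (f : nat -> R) :
  ((fun n => (q n)%:R / f n) @ \oo --> +oo) ->
  forall c, \forall n \near \oo, c <= (q n)%:R / f n.
Proof. by move=> /cvgryPge h c; exact: h. Qed.

Lemma upper_bound_at (eps delta : R) (n q : nat) (s : 'I_q) (Z : nat) :
  0 < eps < 1 -> 0 < delta -> (1 < Z)%N -> 4 * ln (4 * dg_alpha eps) <= Z%:R ->
  (1 < n)%N -> 192 <= q%:R / n%:R :> R -> 192 <= ln n%:R :> R -> 12 * Z%:R <= ln n%:R :> R ->
  expR (- n%:R) <= 2 * delta ^+ 2 ->
  dg_d n q s ((n%:R * q%:R ^+ 2 * ln (dg_alpha eps * n%:R) / (8 * pi ^+ 2))
             * (1 - 1 / (3 * q%:R))^-1) <= eps + delta.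
Proof.
move=> eps01 d0 Z1 hZ n1 qn ln1 lnZ en.
have [a16 aE] := dg_alpha_spec eps01; set a := dg_alpha eps in hZ a16 aE *.
have /andP [e0 e1] := eps01.
have q_gt0 : (0 < q)%N by case: (q) s => // -[].
have nR : 0 < n%:R :> R by rewrite ltr0n ltnW.
have q1 : 1 <= q%:R :> R by rewrite ler1n.
have a0 : 0 < a by lra.
set L := ln (a * n%:R); set t := _ / _ * (1 - 1 / (3 * q%:R))^-1.
have LE : L = ln a + ln n%:R by rewrite /L lnM ?posrE.
have la : 0 <= ln a by rewrite ln_ge0 //; lra.
have L0 : 0 <= L by lra.
have tE : t * (1 - 1 / (3 * q%:R)) = n%:R * q%:R ^+ 2 * L / (8 * pi ^+ 2).
  rewrite /t divfK // gt_eqF // subr_gt0 ltr_pdivrMr; lra.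
have nq : (4 * n < q)%N.
  rewrite -(ltr_nat R) natrM; move: qn; rewrite ler_pdivlMr //; lra.
have hs := heat_sum_le n1 q_gt0 L0 tE nq.
have far : (q ^ n)%:R * expR (- (q%:R * L / 64)) <= expR (- n%:R).
  have q0 : 0 < q%:R :> R by lra.
  rewrite natrX -[q%:R in X in X * _]lnK ?posrE // -expRM_natl -expRD ler_expR.
  pose r : R := q%:R / n%:R.
  have qE : q%:R = r * n%:R by rewrite divfK // gt_eqF.
  have r0 : 0 < r by rewrite divr_gt0.
  have lq : ln q%:R <= r + ln n%:R.
    by rewrite qE lnM ?posrE // lerD2r; apply: ltW; exact: ln_sublinear.
  (* Both r and log n are at least 192, so the right side is at least 3 r and at least 3 log n. *)
  have h1 : r + ln n%:R + 1 <= r * ln n%:R / 64.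
    have := qn; rewrite -/r; nra.
  have h2 : r * ln n%:R <= r * L by rewrite ler_pM2l //; lra.
  rewrite {2}qE; have : n%:R * (ln q%:R + 1) <= n%:R * (r * L / 64) by rewrite ler_pM2l //; lra.
  lra.
have near_sum : \sum_(k : table n q | (0 < sqnorm k)%N) gauss_weight n L (sqnorm k) <=
    4 * eps ^+ 2 + expR (- n%:R).
  rewrite (bigID (fun k => (sqnorm k * Z <= n)%N)) /=; apply: lerD.
    apply: le_trans aE.
    apply: weight_head_le => // [|m m0 mZ]; first exact: ltnW.
    by apply: (@head_condition R a n Z) => //; apply: ltW; apply: lt_trans a16; rewrite ltr1n.
  under eq_bigl => k.
    rewrite -ltnNge andb_idl; last by case: (sqnorm k).
    over.
  by apply: weight_tail_le => //; [exact: ltnW|lra|lra].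
have B0 : 0 <= eps + delta by lra.
apply: bigmax_le => // x xs; apply: le_trans (dg_tv_le n1 q_gt0 t xs) _.
rewrite -ler_pdivlMl ?invr_gt0 // invrK -[leRHS]ger0_norm ?mulr_ge0 // -sqrtr_sqr.
(* The total is at most 4 eps^2 + 2 exp (- n) <= 4 eps^2 + 4 delta^2, below the square of 2 (eps +
   delta). *)
rewrite ler_sqrt ?sqr_ge0 //; apply: le_trans hs _.
nra.
Qed.

(** [tv_lower_bound] at the corner table, with 1 - cos th <= th^2 / 2 for th = 2 pi / q; 4 <= q
    makes the cosine nonnegative. *)
Lemma lower_bound_at (eps t : R) (n q : nat) (s : 'I_q) :
  0 < eps < 1 -> (1 < n)%N -> (4 <= q)%N -> 0 <= t -> dg_d n q s t <= eps ->
  n%:R * q%:R ^+ 2 / (8 * pi ^+ 2)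
          * (ln n%:R + ln (1 - 1 / n%:R) + ln ((eps^-1 - 1) / 5)) <= t.
Proof.
move=> /andP [e0 e1] n1 q4 t0 hd.
have q_gt0 : (0 < q)%N by apply: leq_trans q4.
have nR : 2 <= n%:R :> R by rewrite ler_nat.
have n0 : 0 < n%:R :> R by lra.
have qR : 4 <= q%:R :> R by rewrite ler_nat.
have p0 := pi_gt0 R.
have th : angle R q 1 = 2 * pi / q%:R by rewrite /angle mulr1.
have w0 : 0 <= root_cos R q 1.
  rewrite /root_cos th; apply: cos_ge0_pihalf; apply/andP; split.
    by apply: (@le_trans _ _ 0); [lra|rewrite divr_ge0 //; lra].
  by rewrite ler_pdivrMr; [nra|lra].
have := @tv_lower_bound R n q n1 q_gt0 s t eps (leq_trans _ q4) t0 w0.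
move=> /(_ isT) h.
have {h} h : (n - 1)%:R * expR (- (2 * t * (2 / n%:R * (1 - root_cos R q 1)))) * (1 - eps) <= 4 * eps.
  apply: h; apply: le_trans hd.
  exact: (le_bigmax_cond _ (fun x => dg_tv s t x) (corner_Omega n1 q_gt0 s)).
set X := 2 * t * _ in h.
have XE : X <= 8 * pi ^+ 2 * t / (n%:R * q%:R ^+ 2).
  have hc : 1 - root_cos R q 1 <= (2 * pi / q%:R) ^+ 2 / 2 by rewrite /root_cos th; exact: one_sub_cos_le.
  rewrite (_ : _ / _ = 2 * t * (2 / n%:R * ((2 * pi / q%:R) ^+ 2 / 2))); last first.
    by field; rewrite !gt_eqF //; lra.
  by rewrite /X !ler_wpM2l // ?mulr_ge0 // ?invr_ge0; lra.
have N0 : 0 < (n - 1)%:R :> R by rewrite ltr0n subn_gt0.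
have g0 : 0 < eps^-1 - 1 by rewrite subr_gt0 invf_gt1.
have VX : ln n%:R + ln (1 - 1 / n%:R) + ln ((eps^-1 - 1) / 5) <= X.
  have i1 : 0 < 1 - 1 / n%:R :> R by rewrite subr_gt0 ltr_pdivrMr; lra.
  rewrite -!lnM ?posrE ?mulr_gt0 ?divr_gt0 //.
  have -> : n%:R * (1 - 1 / n%:R) = (n - 1)%:R :> R.
    by rewrite (natrN1 R n1); field; rewrite gt_eqF // addr_gt0.
  rewrite -[X in _ <= X]expRK ler_ln ?posrE ?expR_gt0 ?mulr_gt0 ?divr_gt0 //.
  move: h; rewrite expRN -[_ * _ * (1 - eps)]mulrA [_^-1 * _]mulrC mulrA ler_pdivrMr ?expR_gt0 //.
  move=> h; rewrite (_ : _ * (_ / 5) = ((n - 1)%:R * (1 - eps)) / (5 * eps)); last by field; rewrite gt_eqF.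
  (* The constant 4 in [h] is weakened to 5. *)
  rewrite ler_pdivrMr ?mulr_gt0 //; have := expR_gt0 X; nra.
apply: (@le_trans _ _ (n%:R * q%:R ^+ 2 / (8 * pi ^+ 2) * X)).
  by rewrite ler_wpM2l // divr_ge0 ?mulr_ge0 ?exprn_ge0 //; lra.
have c0 : 0 < 8 * pi ^+ 2 :> R by rewrite mulr_gt0 ?exprn_gt0.
have b0 : 0 < n%:R * q%:R ^+ 2 :> R by rewrite mulr_gt0 ?exprn_gt0 //; lra.
rewrite mulrAC ler_pdivrMr //; move: XE; rewrite ler_pdivlMr //.
by rewrite mulrC [t * _]mulrC.
Qed.

End Asymptotics.

Theorem theorem1 (R : realType) (eps : R) (q : nat -> nat)
  (s : forall n : nat, 'I_(q n)) :
  0 < eps < 1 -> (forall n, (0 < q n)%N) ->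
  ( ((fun n : nat => (q n)%:R / n%:R : R) @ \oo --> +oo) ->
    forall delta : R, 0 < delta ->
      \forall n \near \oo,
        dg_d n (q n) (s n)
          ((n%:R * (q n)%:R ^+ 2 * ln (dg_alpha eps * n%:R) / (8 * pi ^+ 2))
             * (1 - 1 / (3 * (q n)%:R))^-1)
        <= eps + delta )
  /\
  ( ((fun n : nat => (q n)%:R / Num.sqrt (ln (n%:R : R))) @ \oo --> +oo) ->
    \forall n \near \oo,
      ((n%:R * (q n)%:R ^+ 2 / (8 * pi ^+ 2)
          * (ln (n%:R : R) + ln (1 - 1 / n%:R) + ln ((eps^-1 - 1) / 5)))%:E
        <= dg_tmix n (q n) (s n) eps)%E ).
Proof.
move=> eps01 q_gt0; split=> [/ratio_near hq delta d0|/ratio_near hq].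
  (* The threshold between small and large norms depends on [eps] only, so it is fixed before n
     grows. *)
  have [Z hZ] : exists Z : nat, Num.max 2 (4 * ln (4 * dg_alpha eps)) <= Z%:R.
    by exists (Num.truncn (Num.max 2 (4 * ln (4 * dg_alpha eps)))).+1; apply: ltW; exact: truncnS_gt.
  move: hZ; rewrite ge_max => /andP [Z2 hZ].
  near=> n; have n2 : 2 <= n%:R :> R by near: n; exact: nbhs_infty_ger.
  apply: (@upper_bound_at R eps delta n (q n) (s n) Z) => //.
  - by rewrite -(ltr_nat R); lra.
  - by rewrite -(ltr_nat R); lra.
  - by near: n; exact: hq.
  - by near: n; exact: ln_natr_near.
  - by near: n; exact: ln_natr_near.
  - have d2 : 0 < 2 * delta ^+ 2 by rewrite mulr_gt0 ?exprn_gt0.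
    rewrite -[leRHS]lnK ?posrE // ler_expR lerNl.
    by near: n; exact: nbhs_infty_ger.
near=> n.
have n2 : 2 <= n%:R :> R by near: n; exact: nbhs_infty_ger.
have l1 : 1 <= ln n%:R :> R by near: n; exact: ln_natr_near.
have q4 : 4 <= (q n)%:R / Num.sqrt (ln n%:R) :> R by near: n; exact: hq.
have s1 : 1 <= Num.sqrt (ln n%:R) :> R by rewrite -[leLHS]sqrtr1 ler_sqrt //; lra.
(* It suffices to bound every admissible time; an empty set has infimum +oo. *)
apply: le_ereal_inf_tmp => _ [t [t0 ht] <-]; rewrite lee_fin.
apply: (@lower_bound_at R eps t n (q n) (s n)) => //.
  by rewrite -(ltr_nat R); lra.
rewrite -(ler_nat R); move: q4; rewrite ler_pdivlMr; [nra|lra].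
Unshelve. all: by end_near. Qed.
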